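(* Let $N=2^{\mathsf n}>4$ and $t\ge1$ an integer. Let $\mathbf Y_{\mathsf n}$ be the set of $\mathsf n$-qubit Pauli operators (tensor products of $\mathbf 1_2,\sigma^x,\sigma^y,\sigma^z$) containing an odd number of tensor factors equal to $\sigma^y$. Then \[ \Big\|\mathbb E_{\theta\sim(-2\pi,2\pi),\,P\in\mathbf Y_{\mathsf n}}\big(e^{\mathrm i\theta P/2}\big)^{\otimes t}-\mathbb E_{O\sim\mathrm{SO}(N)}O^{\otimes t}\Big\|\le1-\frac1{2t}\frac{N-2}{N-1}-\frac2{N(N-1)}, \] where $\theta$ and $P$ are independent and uniform and $O$ is Haar-distributed on $\mathrm{SO}(N)$.
   Context: For $P\in\mathbf Y_{\mathsf n}$, $\mathrm iP$ is a real antisymmetric matrix, so $e^{\mathrm i\theta P/2}\in\mathrm{SO}(N)$. $\|\cdot\|$ is the operator norm. *)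

(* Defs.v *)
From HB Require Import structures.
From mathcomp Require Import all_boot all_order all_algebra.
From mathcomp Require Import complex mxtens.
From mathcomp Require Import all_classical all_reals all_analysis.

Set Implicit Arguments.
Unset Strict Implicit.
Unset Printing Implicit Defensive.

Import Order.TTheory GRing.Theory Num.Theory.
Import numFieldTopology.Exports numFieldNormedType.Exports.
Local Open Scope classical_set_scope.
Local Open Scope ring_scope.

Section Defs.
Variable R : realType.
Local Notation C := (R[i]).

Definition sigma_x : 'M[C]_2 := \matrix_(i < 2, j < 2) (if i != j then 1 else 0).
Definition sigma_y : 'M[C]_2 :=
  \matrix_(i < 2, j < 2)
    (if (val i == 0%N) && (val j == 1%N) then - 'i
     else if (val i == 1%N) && (val j == 0%N) then 'i else 0).
Definition sigma_z : 'M[C]_2 :=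
  \matrix_(i < 2, j < 2) (if i == j then (if val i == 0%N then 1 else -1) else 0).

Definition pauli1 (a : 'I_4) : 'M[C]_2 :=
  match val a with
  | 0%N => 1%:M
  | 1%N => sigma_x
  | 2%N => sigma_y
  | _ => sigma_z
  end.

Fixpoint pauli_seq (s : seq 'I_4) : 'M[C]_(2 ^ size s) :=
  match s return 'M[C]_(2 ^ size s) with
  | [::] => castmx (esym (expn0 2), esym (expn0 2)) 1%:M
  | a :: s' => castmx (esym (expnS 2 (size s')), esym (expnS 2 (size s')))
                 (tensmx (pauli1 a) (pauli_seq s'))
  end.

Definition pauli_op (n : nat) (w : n.-tuple 'I_4) : 'M[C]_(2 ^ n) :=
  castmx (congr1 (expn 2) (size_tuple w), congr1 (expn 2) (size_tuple w))
    (pauli_seq w).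

Definition Yset (n : nat) : {set n.-tuple 'I_4} :=
  [set w : n.-tuple 'I_4 | odd (count (fun a : 'I_4 => val a == 2%N) w)].

(* The real matrix iP (iP is real, since P has an odd number of sigma^y). *)
Definition iP_real (n : nat) (w : n.-tuple 'I_4) : 'M[R]_(2 ^ n) :=
  map_mx (fun z : C => complex.Re z) ('i *: pauli_op w).

Definition mexp (K : nat) (A : 'M[R]_K) : 'M[R]_K :=
  \matrix_(i, j) limn ((fun m : nat => (\sum_(l < m) (l`!%:R)^-1 *: A ^+ l) i j) : nat -> R).

Definition norm2 (K : nat) (v : 'cV[R]_K) : R :=
  Num.sqrt (\sum_(i < K) v i ord0 ^+ 2).

Definition opnorm (K : nat) (A : 'M[R]_K) : R :=
  sup [set norm2 (A *m v) | v in [set v : 'cV[R]_K | norm2 v <= 1]].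

Definition SOset (K : nat) : set 'M[R]_K :=
  [set M | M^T *m M = 1%:M /\ \det M = 1].

Definition MxBorel (K : nat) := g_sigma_algebraType (@open 'M[R]_K).

Definition is_haar_SO (K : nat) (mu : probability (MxBorel K) R) : Prop :=
  measurable (@SOset K : set (MxBorel K)) /\
  mu (@SOset K : set (MxBorel K)) = 1%E /\
  forall g : 'M[R]_K, @SOset K g ->
    forall B : set (MxBorel K), measurable B ->
      mu ((fun M : MxBorel K => (g *m M : MxBorel K)) @^-1` B) = mu B.

Definition avg_Y (n t : nat) : 'M[R]_((2 ^ n) ^ t) :=
  (#|Yset n|%:R)^-1 *:
  \sum_(w in Yset n)
    \matrix_(I, J)
      ((4 * pi)^-1 *
       \int[@lebesgue_measure R]_(x in [set x : R | - (2 * pi) < x < 2 * pi])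
          (ntensmx (mexp ((x / 2) *: iP_real w)) t) I J).

Definition avg_haar (K t : nat) (mu : probability (MxBorel K) R) : 'M[R]_(K ^ t) :=
  \matrix_(I, J) \int[mu]_(M in (@SOset K : set (MxBorel K)))
                   (ntensmx (M : 'M[R]_K) t) I J.

End Defs.

(* Main.v *)
(** Put [H_P = sum_j P_j] on the [t]-fold tensor power. The average over [theta] of the
    [t]-th power of [exp(i theta P / 2)] is the orthogonal projection [Q_P] onto
    [ker H_P], the Haar average is the orthogonal projection onto [SO(N)]-invariant
    tensors, which is the common kernel of the [H_P], and the Casimir operator
    [sum_P H_P^2] commutes with all [H_P] and [Q_P]. On an eigenspace of the Casimir with
    eigenvalue [c != 0], let [m <= t] be the largest modulus of an eigenvalue of any [H_P],
    attained by [H_{P0}] at a vector [v]. The Paulis of [Y_n] anticommuting with [P0] come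
    in pairs [P], [P' = -f P0 P] with [f = i] or [f = -i]; the raising operator
    [H_P + f H_{P'}] shifts the eigenvalue of [H_{P0}] by [2], hence kills [v], which
    gives [|H_P v|^2 + |H_{P'} v|^2 = 2 m |v|^2]. Therefore [c >= m^2 + a m], where
    [a = N(N-2)/4] counts the Paulis anticommuting with [P0]. As
    [1 - Q_P >= H_P^2 / m^2] on the eigenspace, the gap is at least
    [c / (m^2 |Y_n|) >= (1 + a / t) / |Y_n|] with [|Y_n| = N(N-1)/2]. *)

Require Import Defs.
From HB Require Import structures.
From mathcomp Require Import all_boot all_order all_algebra.
From mathcomp Require Import complex mxtens ring lra.
From mathcomp Require Import zify.
From mathcomp Require Import all_classical all_reals all_analysis.
From mathcomp Require Import measurable_realfun.

Set Implicit Arguments.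
Unset Strict Implicit.
Unset Printing Implicit Defensive.

Import Order.TTheory GRing.Theory Num.Theory.
Import numFieldTopology.Exports numFieldNormedType.Exports.
Local Open Scope ring_scope.
Local Open Scope sesquilinear_scope.

(** * Hermitian matrices and the spectral gap *)

(** Two choices shape the argument. The estimate of 1 - Q_P uses the largest eigenvalue m of the
    eigenspace at hand and not t: the Casimir bound m^2 + a m shrinks with m, and it is the quotient
    c / m^2 >= 1 + a / m that has a uniform lower bound, 1 + a / t. The maximum is taken over all P
    at once, so that one m serves both the raising argument at P0 and the estimate of every Q_P.
    That the common kernel of the H_P consists of invariant tensors is shown by elementary means.
    SO(N) is generated by rotations in planes, the generator of such a rotation is antisymmetric and
    hence a combination of the P in Y_n, and a tensor killed by a generator has zero derivative
    along its rotations. The spectral part runs over the complex numbers because iP has no real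
    eigenvectors, whereas the averages and the norm are real. Kernels of real matrices split into
    real and imaginary parts, which carries the real projections over. *)

Section HermitianMatrices.
Variable C : numClosedFieldType.

Definition inner d (u v : 'cV[C]_d) : C := (u^t* *m v) 0 0.
Local Notation "''[' u , v ]" := (inner u v) : ring_scope.
Local Notation "''[' u ]" := (inner u u) : ring_scope.

Lemma adjM m n p (A : 'M[C]_(m, n)) (B : 'M[C]_(n, p)) :
  (A *m B)^t* = B^t* *m A^t*.
Proof. by rewrite trmx_mul map_mxM. Qed.

Lemma innerE d (u v : 'cV[C]_d) : '[u, v] = \sum_i (u i 0)^* * v i 0.
Proof. by rewrite /inner mxE; apply: eq_bigr => i _; rewrite !mxE. Qed.

Lemma innerDl d (u v w : 'cV[C]_d) : '[u + v, w] = '[u, w] + '[v, w].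
Proof. by rewrite /inner linearD /= map_mxD mulmxDl mxE. Qed.
Lemma innerDr d (u v w : 'cV[C]_d) : '[w, u + v] = '[w, u] + '[w, v].
Proof. by rewrite /inner mulmxDr mxE. Qed.
Lemma innerBr d (u v w : 'cV[C]_d) : '[w, u - v] = '[w, u] - '[w, v].
Proof. by rewrite /inner mulmxBr !mxE. Qed.
Lemma innerBl d (u v w : 'cV[C]_d) : '[u - v, w] = '[u, w] - '[v, w].
Proof. by rewrite /inner linearB /= map_mxB mulmxBl !mxE. Qed.
Lemma innerZr d c (u w : 'cV[C]_d) : '[w, c *: u] = c * '[w, u].
Proof. by rewrite /inner -scalemxAr mxE. Qed.
Lemma innerZl d c (u w : 'cV[C]_d) : '[c *: u, w] = c^* * '[u, w].
Proof. by rewrite /inner linearZ /= map_mxZ -scalemxAl mxE. Qed.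
Lemma inner_sumr d I (r : seq I) (P : pred I) (F : I -> 'cV[C]_d) w :
  '[w, \sum_(i <- r | P i) F i] = \sum_(i <- r | P i) '[w, F i].
Proof. by rewrite /inner mulmx_sumr summxE. Qed.

Lemma inner_adj d e (A : 'M[C]_(d, e)) u v : '[u, A *m v] = '[A^t* *m u, v].
Proof. by rewrite /inner adjM trmxCK mulmxA. Qed.

Lemma inner_ge0 d (u : 'cV[C]_d) : 0 <= '[u].
Proof. by rewrite innerE sumr_ge0 // => i _; rewrite mulrC mul_conjC_ge0. Qed.

Lemma inner_eq0 d (u : 'cV[C]_d) : '[u] = 0 -> u = 0.
Proof.
rewrite innerE => /eqP; rewrite psumr_eq0; last first.
  by move=> i _; rewrite mulrC mul_conjC_ge0.
move=> /allP u0; apply/matrixP => i j; rewrite ord1 mxE.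
have := u0 i; rewrite mem_index_enum => /(_ isT) /=.
by rewrite mulrC mul_conjC_eq0 => /eqP.
Qed.

Lemma inner_gt0 d (u : 'cV[C]_d) : u != 0 -> 0 < '[u].
Proof.
move=> un0; rewrite lt_def inner_ge0 andbT.
by apply: contra un0 => /eqP /inner_eq0 ->.
Qed.

Lemma inner_unitary d (U : 'M[C]_d) (u : 'cV[C]_d) :
  U^t* *m U = 1%:M -> '[U *m u] = '[u].
Proof. by move=> UU; rewrite inner_adj mulmxA UU mul1mx. Qed.

Lemma hermitian_diag d (A : 'M[C]_d) : A^t* = A ->
  [/\ spectralmx A *m (spectralmx A)^t* = 1%:M, (spectralmx A)^t* *m spectralmx A = 1%:M
    & A = (spectralmx A)^t* *m diag_mx (spectral_diag A) *m spectralmx A].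
Proof.
move=> hA; have nA : A \is normalmx by apply/normalmxP; rewrite hA.
have uU := spectral_unitarymx A; split.
- exact/unitarymxP.
- by apply/mulmx1C/unitarymxP.
- by rewrite -invmx_unitary //; apply/orthomx_spectralP.
Qed.

Lemma eigen_hermitian_real d (A : 'M[C]_d) (v : 'cV[C]_d) a :
  A^t* = A -> v != 0 -> A *m v = a *: v -> a \is Num.real.
Proof.
move=> hA v0 Av; apply/CrealP.
have n0 : '[v] != 0 by rewrite gt_eqF ?inner_gt0.
by apply: (mulIf n0); rewrite -innerZl -innerZr -Av inner_adj hA.
Qed.

Lemma normsqZ d c (u : 'cV[C]_d) : '[c *: u] = `|c| ^+ 2 * '[u].
Proof. by rewrite innerZr innerZl normCK mulrA. Qed.

Lemma inner_diag d (D : 'rV[C]_d) (u : 'cV[C]_d) :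
  '[diag_mx D *m u] = \sum_i `|D 0 i| ^+ 2 * (`|u i 0| ^+ 2).
Proof.
rewrite innerE; apply: eq_bigr => i _; rewrite mul_diag_mx !mxE.
by rewrite -exprMn -normrM normCKC.
Qed.

(** The eigenvector is column [k] of the adjoint of [spectralmx A]. *)
Lemma spectral_diag_eigen d (A : 'M[C]_d) k : A^t* = A ->
  exists2 v : 'cV[C]_d, v != 0 & A *m v = spectral_diag A 0 k *: v.
Proof.
move=> /hermitian_diag [UU' U'U AE]; exists ((spectralmx A)^t* *m delta_mx k 0).
  apply/eqP => /(congr1 (mulmx (spectralmx A))); rewrite mulmxA UU' mul1mx mulmx0.
  by move=> /matrixP /(_ k 0); rewrite !mxE !eqxx => /eqP; rewrite oner_eq0.
rewrite {1}AE -!mulmxA (mulmxA (spectralmx A)) UU' mul1mx scalemxAr; congr (_ *m _).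
apply/matrixP => j l; rewrite mul_diag_mx !mxE.
by case: eqP => [->|]; rewrite ?mulr0.
Qed.

Lemma spectral_diag_bound d (A : 'M[C]_d) b : A^t* = A -> 0 <= b ->
  (forall k, `|spectral_diag A 0 k| <= b) ->
  forall u : 'cV[C]_d, '[A *m u] <= b ^+ 2 * '[u].
Proof.
move=> /hermitian_diag [UU' U'U AE] b0 bA u.
rewrite AE -!mulmxA inner_unitary; last by rewrite trmxCK.
rewrite inner_diag -(inner_unitary u U'U) innerE mulr_sumr.
apply: ler_sum => i _; rewrite -normCKC ler_wpM2r ?exprn_ge0 //.
by rewrite lerXn2r ?nnegrE.
Qed.

Lemma hermitian_bound d (A : 'M[C]_d) b : A^t* = A -> 0 <= b ->
  (forall (v : 'cV[C]_d) a, v != 0 -> A *m v = a *: v -> `|a| <= b) ->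
  forall u : 'cV[C]_d, '[A *m u] <= b ^+ 2 * '[u].
Proof.
move=> hA b0 bA; apply: spectral_diag_bound => // k.
by have [v v0 /(bA _ _ v0)] := spectral_diag_eigen k hA.
Qed.

(** The order of [C] is partial, so a largest element needs all entries to be real. *)
Lemma max_real (s : seq C) : s != [::] -> {in s, forall x, x \is Num.real} ->
  exists2 m, m \in s & {in s, forall x, x <= m}.
Proof.
elim: s => // x s IH _ sr; have [-> |s0] := eqVneq s [::].
  by exists x; rewrite ?mem_head // => y; rewrite inE => /eqP ->.
have [|m ms mP] := IH s0; first by move=> y ys; rewrite sr // inE ys orbT.
have [xr mr] : x \is Num.real /\ m \is Num.real.
  by split; apply: sr; rewrite inE ?eqxx // ms orbT.
have [xm|mx] := real_leP xr mr.
  by exists m; rewrite ?inE ?ms ?orbT // => y; rewrite inE => /predU1P [->|/mP].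
exists x; rewrite ?mem_head // => y; rewrite inE => /predU1P [->//|/mP yx].
exact: le_trans yx (ltW mx).
Qed.

(** Finitely many spectra form a finite list of moduli, whose maximum is attained at an eigenvector
    and bounds every matrix of the family on every vector. *)
Lemma hermitian_family_max d (I : finType) (Y : {set I}) (K : I -> 'M[C]_d) i0 :
  (0 < d)%N -> i0 \in Y -> (forall i, i \in Y -> (K i)^t* = K i) ->
  exists i a (v : 'cV[C]_d), [/\ i \in Y, v != 0, K i *m v = a *: v &
    forall j u, j \in Y -> '[K j *m u] <= `|a| ^+ 2 * '[u]].
Proof.
move=> d0 i0Y hK.
pose s := [seq `|spectral_diag (K p.1) 0 p.2| | p <- enum (finset.setX Y [set: 'I_d])].
have s0 : s != [::].
  rewrite -size_eq0 size_map -cardE cardsX cardsT card_ord muln_eq0 negb_or.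
  by rewrite -!lt0n d0 andbT; apply/card_gt0P; exists i0.
have sr : {in s, forall x, x \is Num.real} by move=> _ /mapP [p _ ->]; apply: normr_real.
have [m ms mP] := max_real s0 sr.
move: ms => /mapP [[i k] ik mE]; rewrite {m}mE /= in mP.
move: ik; rewrite mem_enum inE /= => /andP [iY _].
have [v v0 Kv] := spectral_diag_eigen k (hK i iY).
exists i, (spectral_diag (K i) 0 k), v; split => // j u jY.
apply: spectral_diag_bound; rewrite ?hK // => l.
by apply: mP; apply/mapP; exists (j, l); rewrite ?mem_enum ?inE ?jY.
Qed.

(** Functional calculus: the indicator function of [c] applied to [A]; it is 0 when [c] is not an
    eigenvalue. *)
Definition eigenproj d (A : 'M[C]_d) c : 'M[C]_d :=
  (spectralmx A)^t* *m diag_mx (\row_j (spectral_diag A 0 j == c)%:R) *m spectralmx A.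

Lemma eigenproj_herm d (A : 'M[C]_d) c : (eigenproj A c)^t* = eigenproj A c.
Proof.
rewrite /eigenproj !adjM trmxCK mulmxA tr_diag_mx map_diag_mx.
by congr (_ *m diag_mx _ *m _); apply/rowP => j; rewrite !mxE rmorph_nat.
Qed.

Lemma eigenproj_idem d (A : 'M[C]_d) c : A^t* = A ->
  eigenproj A c *m eigenproj A c = eigenproj A c.
Proof.
move=> /hermitian_diag [UU' _ _].
rewrite /eigenproj -!mulmxA (mulmxA (spectralmx A)) UU' mul1mx; congr (_ *m _).
rewrite mulmxA mulmx_diag; congr (diag_mx _ *m _).
by apply/rowP => j; rewrite !mxE -natrM mulnb andbb.
Qed.

Lemma eigenproj_eigen d (A : 'M[C]_d) c : A^t* = A ->
  A *m eigenproj A c = c *: eigenproj A c.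
Proof.
move=> /hermitian_diag [UU' _ AE].
rewrite {1}AE /eigenproj -!mulmxA (mulmxA (spectralmx A)) UU' mul1mx scalemxAr.
congr (_ *m _); rewrite mulmxA mulmx_diag scalemxAl; congr (_ *m _).
apply/matrixP => i j; rewrite !mxE; case: (eqVneq i j) => [->|]; last by rewrite !mulr0n mulr0.
by case: eqP => [->|]; rewrite ?mulr0 ?mulr1.
Qed.

(** In an eigenbasis of [A], a commuting [X] has nonzero entries only between equal eigenvalues, so
    it commutes with every function of [A]. *)
Lemma eigenproj_comm d (A X : 'M[C]_d) c : A^t* = A ->
  A *m X = X *m A -> eigenproj A c *m X = X *m eigenproj A c.
Proof.
move=> /hermitian_diag [UU' U'U AE] AX.
set U := spectralmx A in UU' U'U AE *; set D := spectral_diag A in AE *.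
pose X' := U *m X *m U^t*.
have XE : X = U^t* *m X' *m U.
  by rewrite /X' !mulmxA U'U mul1mx -mulmxA U'U mulmx1.
have DX : diag_mx D *m X' = X' *m diag_mx D.
  rewrite /X' (_ : diag_mx D = U *m A *m U^t*); last first.
    by rewrite AE !mulmxA UU' mul1mx -mulmxA UU' mulmx1.
  rewrite -!mulmxA !(mulmxA (U^t*) U) U'U !mul1mx (mulmxA A) AX.
  by rewrite !mulmxA.
clearbody X'; have {DX} DX i j : X' i j != 0 -> D 0 i = D 0 j.
  move=> x0; move/matrixP: DX => /(_ i j); rewrite mul_diag_mx mul_mx_diag !mxE mulrC.
  exact: (mulfI x0).
rewrite /eigenproj -/U -/D XE -!mulmxA !(mulmxA U (U^t*)) UU' !mul1mx.
rewrite !mulmxA; congr (_ *m _); rewrite -!mulmxA; congr (_ *m _).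
apply/matrixP => i j; rewrite mul_diag_mx mul_mx_diag !mxE mulrC.
by have [->|/DX ->] := eqVneq (X' i j) 0; rewrite ?mul0r.
Qed.

Lemma eigenproj_neq0 d (A : 'M[C]_d) (v : 'cV[C]_d) : A^t* = A -> v != 0 ->
  exists c, eigenproj A c *m v != 0.
Proof.
move=> /hermitian_diag [UU' U'U AE] v0.
set U := spectralmx A in UU' U'U AE *; set D := spectral_diag A in AE *.
have : U *m v != 0.
  apply: contra v0 => /eqP /(congr1 (mulmx (U^t*))).
  by rewrite mulmxA U'U mul1mx mulmx0 => ->.
move=> /matrix0Pn [i [j]]; rewrite ord1 => Uv0; exists (D 0 i).
apply: contra Uv0 => /eqP /(congr1 (mulmx U)); rewrite mulmx0.
rewrite /eigenproj -!mulmxA (mulmxA U (U^t*)) UU' mul1mx.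
by move=> /matrixP /(_ i 0); rewrite mul_diag_mx !mxE eqxx mul1r => ->.
Qed.

(** Doubling the sum avoids choosing one representative in each pair of the involution. It serves
    both the cancellation in the Casimir ([c = 0]) and its lower bound. *)
Lemma sum_involution (V : zmodType) (I : finType) (A : {set I}) (s : I -> I)
    (F : I -> V) c :
  (forall i, i \in A -> [/\ s i \in A, s (s i) = i & F i + F (s i) = c]) ->
  (\sum_(i in A) F i) *+ 2 = c *+ #|A|.
Proof.
move=> sA; have FE : \sum_(i in A) F i = \sum_(i in A) F (s i).
  rewrite (reindex_onto s s) /=; last by move=> i /sA [].
  apply: eq_bigl => i; apply/andP/idP => [[siA /eqP si]|/sA [? -> _]//].
  by rewrite -si; case: (sA _ siA).
rewrite mulr2n [X in _ + X]FE -big_split /= -sumr_const.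
by apply: eq_bigr => i /sA [].
Qed.

(* Here [f] is [i] or [-i], and [X + f X'] raises the eigenvalues of [X0] by [2]. *)
Definition raising_triple d (X0 X X' : 'M[C]_d) := exists2 f : C, f ^+ 2 = -1 &
  [/\ X0 *m X - X *m X0 = (2 * f) *: X', X0 *m X' - X' *m X0 = - (2 * f) *: X
    & X *m X' - X' *m X = (2 * f) *: X0].

Lemma conj_sqrtN1 (f : C) : f ^+ 2 = -1 -> f^* = - f.
Proof.
move=> f2; have f0 : f != 0.
  by apply/eqP => f0; move/eqP: f2; rewrite f0 expr0n /= eq_sym oppr_eq0 oner_eq0.
have nf : `|f| = 1.
  apply/eqP; rewrite -(@eqrXn2 _ 2) ?ler01 ?normr_ge0 // -normrX f2 normrN1.
  by rewrite expr1n.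
by apply: (mulfI f0); rewrite -normCK nf expr1n mulrN -expr2 f2 opprK.
Qed.

(** Leibniz rule. The result is symmetric in [X] and [X'], so two partners with opposite
    coefficients cancel. *)
Lemma commutator_square d (X0 X X' : 'M[C]_d) c : X0 *m X - X *m X0 = c *: X' ->
  X0 *m (X *m X) - X *m X *m X0 = c *: (X' *m X + X *m X').
Proof.
move=> e; rewrite scalerDr scalemxAl scalemxAr -e mulmxBl mulmxBr !mulmxA.
by rewrite addrA subrK.
Qed.

(* For [s = 1] or [s = -1], the norm of [X v + s f X' v] vanishes by maximality of [m]. *)
Lemma raising_triple_top d (X0 X X' : 'M[C]_d) (v : 'cV[C]_d) (s m : C) :
  X^t* = X -> X'^t* = X' -> raising_triple X0 X X' ->
  s ^+ 2 = 1 -> s \is Num.real -> X0 *m v = (s * m) *: v ->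
  (forall f : C, X0 *m (X *m v + f *: (X' *m v)) =
      (s * (m + 2)) *: (X *m v + f *: (X' *m v)) -> X *m v + f *: (X' *m v) = 0) ->
  '[v, X *m X *m v] + '[v, X' *m X' *m v] = 2 * m * '[v].
Proof.
move=> hX hX' [f f2 [e1 e2 e3]] s2 sr X0v top.
have fc := conj_sqrtN1 f2.
have sc : s^* = s by apply/CrealP.
have ep : X0 *m (X *m v) = (2 * f) *: (X' *m v) + (s * m) *: (X *m v).
  by move/(canRL (subrK _)): e1; rewrite mulmxA => ->; rewrite mulmxDl -mulmxA X0v -scalemxAr -scalemxAl.
have eq : X0 *m (X' *m v) = - (2 * f) *: (X *m v) + (s * m) *: (X' *m v).
  by move/(canRL (subrK _)): e2; rewrite mulmxA => ->; rewrite mulmxDl -mulmxA X0v -scalemxAr -scalemxAl.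
have w0 : X *m v + (s * f) *: (X' *m v) = 0.
  apply: top; rewrite mulmxDr -scalemxAr ep eq !scalerDr !scalerA.
  rewrite [(2 * f) *: _ + _]addrC addrACA -!scalerDl; congr (_ *: _ + _ *: _).
    rewrite (_ : _ + _ = s * m + (- f ^+ 2) * (2 * s)); last by ring.
    by rewrite f2; ring.
  rewrite (_ : s * (m + 2) * _ = s ^+ 2 * ((m + 2) * f)); last by ring.
  rewrite (_ : 2 * f + _ = 2 * f + s ^+ 2 * (m * f)); last by ring.
  by rewrite s2; ring.
rewrite -(mulmxA X) (inner_adj X v) -(mulmxA X') (inner_adj X' v) hX hX'.
have : '[X *m v + (s * f) *: (X' *m v)] = 0 by rewrite w0 /inner mulmx0 mxE.
rewrite innerDl !innerDr !innerZl !innerZr rmorphM /= fc sc.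
(* The cross terms of the squared norm cancel up to the commutator of [X] and [X'], a multiple of
   [X0]; this leftover produces the 2 m. *)
rewrite (_ : '[X' *m v, X *m v] = '[X *m v, X' *m v] - 2 * f * s * m * '[v]); last first.
  rewrite -{1}hX' -inner_adj -{2}hX -inner_adj mulmxA.
  rewrite -[X' *m X](subKr (X *m X')) e3 mulmxBl innerBr -mulmxA.
  by rewrite -scalemxAl X0v !innerZr !mulrA.
rewrite (_ : _ + _ = '[X *m v] - f ^+ 2 * s ^+ 2 * '[X' *m v] +
   (2 * f ^+ 2 * s ^+ 2 * m) * '[v]); last by ring.
rewrite f2 s2 => /eqP; rewrite (_ : _ + _ = '[X *m v] + '[X' *m v] - 2 * m * '[v]); last by ring.
by rewrite subr_eq0 => /eqP.
Qed.

(** * Spectral gap from abstract commutation relations *)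

Section SpectralGap.
(** [A i] stands for the indices anticommuting with [i], [sg i] for their pairing, [Q i] for the
    projection onto the kernel of [H i], [G] for the projection onto the common kernel. *)
Variables (d : nat) (I : finType) (Y : {set I}) (H Q : I -> 'M[C]_d) (G : 'M[C]_d).
Variables (A : I -> {set I}) (sg : I -> I -> I) (t a : nat).
Hypothesis H_herm : forall i, i \in Y -> (H i)^t* = H i.
Hypothesis H_bound : forall i u, i \in Y -> '[H i *m u] <= t%:R ^+ 2 * '[u].
Hypothesis A_sub : forall i, i \in Y -> A i \subset Y :\ i.
Hypothesis A_card : forall i, i \in Y -> #|A i| = a.
Hypothesis H_comm : forall i j, i \in Y -> j \in Y -> j \notin A i ->
  H i *m H j = H j *m H i.
Hypothesis H_raise : forall i j, i \in Y -> j \in A i ->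
  [/\ sg i j \in A i, sg i (sg i j) = j & raising_triple (H i) (H j) (H (sg i j))].
Hypothesis Q_herm : forall i, i \in Y -> (Q i)^t* = Q i.
Hypothesis Q_idem : forall i, i \in Y -> Q i *m Q i = Q i.
Hypothesis HQ : forall i, i \in Y -> H i *m Q i = 0.
Hypothesis Q_fix : forall i (u : 'M[C]_d), i \in Y -> H i *m u = 0 -> Q i *m u = u.
Hypothesis G_herm : G^t* = G.
Hypothesis HG : forall i, i \in Y -> H i *m G = 0.
Hypothesis G_fix : forall u : 'cV[C]_d, (forall i, i \in Y -> H i *m u = 0) -> G *m u = u.

Let casimir : 'M[C]_d := \sum_(i in Y) H i *m H i.

Let casimir_herm : casimir^t* = casimir.
Proof.
rewrite /casimir raddf_sum raddf_sum /=; apply: eq_bigr => i iY.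
by rewrite adjM H_herm.
Qed.

(** Squares [H j *m H j] with [j] outside [A i] commute with [H i]; inside, the commutators for [j]
    and [sg i j] are opposite. *)
Let casimir_comm i : i \in Y -> casimir *m H i = H i *m casimir.
Proof.
move=> iY; apply/eqP; rewrite eq_sym -subr_eq0 mulmx_sumr mulmx_suml -sumrB.
pose D j := H i *m (H j *m H j) - H j *m H j *m H i.
have D0 : (\sum_(j in A i) D j) *+ 2 = 0 *+ #|A i|.
  apply: (@sum_involution _ _ _ (sg i)) => j jA.
  have [sA ss [f _ [e1 e2 _]]] := H_raise iY jA; split => //.
  rewrite /D (commutator_square e1) (commutator_square e2).
  by rewrite scaleNr [X in _ - _ *: X]addrC subrr.
rewrite (bigID (mem (A i))) /= [X in _ + X]big1 ?addr0; last first.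
  move=> j /andP [jY jA]; have e := H_comm iY jY jA.
  by rewrite mulmxA e -!mulmxA e subrr.
rewrite mul0rn in D0; rewrite (eq_bigl (mem (A i))).
  move/eqP: D0; rewrite -scaler_nat scaler_eq0 pnatr_eq0 /= => /eqP ->//.
move=> j; rewrite andb_idl // => jA.
by have /fintype.subsetP /(_ j jA) := A_sub iY; rewrite inE => /andP [].
Qed.

(* [Q i] is the orthogonal projection onto [ker (H i)], which the Casimir preserves. *)
Let casimirQ i : i \in Y -> casimir *m Q i = Q i *m casimir.
Proof.
move=> iY; have e : Q i *m (casimir *m Q i) = casimir *m Q i.
  by apply: Q_fix => //; rewrite mulmxA -casimir_comm // -mulmxA HQ // mulmx0.
have := congr1 (fun X => X^t*) e.
by rewrite !adjM !Q_herm // casimir_herm -mulmxA e.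
Qed.

Let GH i : i \in Y -> G *m H i = 0.
Proof.
move=> iY; have := congr1 (fun X => X^t*) (HG iY).
by rewrite adjM H_herm // G_herm trmx0 map_mx0.
Qed.

Let T : 'M[C]_d := #|Y|%:R^-1 *: \sum_(i in Y) Q i - G.

Theorem gap_eigenvalue (lam : C) (v : 'cV[C]_d) : (0 < #|Y|)%N -> (0 < t)%N ->
  lam != 0 -> v != 0 -> T *m v = lam *: v ->
  0 <= lam <= 1 - (1 + a%:R / t%:R) / #|Y|%:R.
Proof.
move=> Y0 t0 lam0 v0 Tv.
have cardY : 0 < #|Y|%:R :> C by rewrite ltr0n.
have /card_gt0P [j0 j0Y] := Y0.
have d0 : (0 < d)%N.
  by rewrite lt0n; apply: contra v0 => /eqP d0; apply/eqP/matrixP => -[x xd]; exfalso; move: xd; rewrite d0.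
have comG : casimir *m G = G *m casimir.
  rewrite mulmx_suml mulmx_sumr; apply: eq_bigr => i iY.
  by rewrite -mulmxA HG // mulmx0 mulmxA GH // mul0mx.
have comT : casimir *m T = T *m casimir.
  rewrite mulmxBr mulmxBl comG -scalemxAr -scalemxAl mulmx_sumr mulmx_suml.
  by congr (_ *: _ - _); apply: eq_bigr => i iY; rewrite casimirQ.
have QG i : i \in Y -> Q i *m G = G by move=> iY; apply: Q_fix; rewrite ?HG.
have GQ i : i \in Y -> G *m Q i = G.
  by move=> iY; rewrite -{1}G_herm -(Q_herm iY) -adjM QG // G_herm.
have GG : G *m G = G.
  apply/matrixP => k l; have -> : (G *m G) k l = (G *m col l G) k 0.
    by rewrite colE mulmxA -colE [RHS]mxE.
  by rewrite G_fix ?mxE // => i iY; rewrite colE mulmxA HG // mul0mx.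
have GT : G *m T = 0.
  rewrite mulmxBr GG -scalemxAr mulmx_sumr (eq_bigr (fun=> G)) // sumr_const.
  by rewrite -(scaler_nat #|Y| G) scalerA mulVf ?scale1r ?subrr // gt_eqF.
(* The Casimir commutes with [T], so [v] may be replaced by a nonzero component [w] in one Casimir
   eigenspace, still an eigenvector of [T] for [lam]. *)
have [c w0] := eigenproj_neq0 casimir_herm v0.
set Pi := eigenproj casimir c in w0; set w := Pi *m v in w0.
have Pi_herm : Pi^t* = Pi by apply: eigenproj_herm.
have Pi_idem : Pi *m Pi = Pi by apply: eigenproj_idem.
have PiH i : i \in Y -> Pi *m H i = H i *m Pi.
  by move=> iY; apply: eigenproj_comm => //; apply: casimir_comm.
have PiQ i : i \in Y -> Pi *m Q i = Q i *m Pi.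
  by move=> iY; apply: eigenproj_comm => //; apply: casimirQ.
have PiT : Pi *m T = T *m Pi by apply: eigenproj_comm.
have casPiM : casimir *m Pi = c *: Pi by apply: eigenproj_eigen.
clearbody Pi.
have casPi x : Pi *m x = x -> casimir *m x = c *: x.
  by move=> Px; rewrite -Px mulmxA casPiM scalemxAl.
have Piw : Pi *m w = w by rewrite /w mulmxA Pi_idem.
have Tw : T *m w = lam *: w by rewrite /w mulmxA -PiT -mulmxA Tv scalemxAr.
clearbody w.
have Gw : G *m w = 0.
  apply: (scalerI lam0); rewrite scaler0 scalemxAr -Tw mulmxA GT mul0mx //.
have Hnorm i u : i \in Y -> '[H i *m u] = '[u, H i *m H i *m u].
  by move=> iY; rewrite -mulmxA (inner_adj _ u) H_herm.
have cas_inner u : '[u, casimir *m u] = \sum_(i in Y) '[H i *m u].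
  by rewrite mulmx_suml inner_sumr; apply: eq_bigr => i iY; rewrite Hnorm.
(* [H i *m Pi] is the restriction of [H i] to the eigenspace, extended by 0; its eigenvectors with
   nonzero eigenvalue lie in the range of [Pi]. *)
have K_herm i : i \in Y -> (H i *m Pi)^t* = H i *m Pi.
  by move=> iY; rewrite adjM Pi_herm H_herm // PiH.
have [i [mu [u [iY u0 Ku Kmax]]]] := hermitian_family_max d0 j0Y K_herm.
have mur : mu \is Num.real by apply: (eigen_hermitian_real _ u0 Ku); rewrite K_herm.
(* If every [H j] vanished on the eigenspace, [w] would lie in the common kernel, against
   [G *m w = 0]. *)
have mu0 : mu != 0.
  apply/eqP => mu0; rewrite mu0 normr0 expr0n /= in Kmax.
  have : G *m w = w.
    apply: G_fix => j jY; apply: inner_eq0; apply/eqP.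
    by have := Kmax j w jY; rewrite mul0r -mulmxA Piw eq_le inner_ge0 andbT.
  by rewrite Gw => /esym /eqP; rewrite (negPf w0).
have Piu : Pi *m u = u.
  apply: (scalerI mu0); rewrite scalemxAr -Ku !mulmxA PiH //.
  by rewrite -!mulmxA (mulmxA Pi Pi u) Pi_idem.
have Hu : H i *m u = mu *: u by rewrite -Ku -mulmxA Piu.
pose m := `|mu|; have m0 : 0 < m by rewrite normr_gt0.
(* The sign of [mu]: the shift by 2 is taken away from zero, whichever end of the spectrum attains
   the maximum. *)
pose s := mu / m.
have sr : s \is Num.real by rewrite realM // realV normr_real.
have sm : mu = s * m by rewrite /s divfK // gt_eqF.
have s2 : s ^+ 2 = 1.
  by rewrite expr_div_n /m real_normK // divff // expf_eq0.
have mt : m <= t%:R.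
  have := H_bound u iY; rewrite Hu normsqZ ler_pM2r ?inner_gt0 //.
  by rewrite ler_pXn2r ?nnegrE ?normr_ge0 ?ler0n.
have top j : j \in A i ->
  '[H j *m u] + '[H (sg i j) *m u] = 2 * m * '[u].
  move=> jA; have [sA _ tr] := H_raise iY jA.
  have AY k : k \in A i -> k \in Y.
    by move=> kA; have /fintype.subsetP /(_ k kA) := A_sub iY; rewrite inE => /andP [].
  rewrite !Hnorm ?AY //; apply: (raising_triple_top _ _ tr s2 sr);
    rewrite ?H_herm ?AY -?sm // => f e.
  set z := _ + _ in e *; apply: inner_eq0; apply/eqP.
  (* The shifted vector stays in the eigenspace, where its eigenvalue of modulus m + 2 would exceed
     the maximum m; hence it is 0. *)
  have Piz : Pi *m z = z.
    by rewrite /z mulmxDr -scalemxAr !mulmxA !PiH ?AY // -!mulmxA Piu.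
  have := Kmax i z iY; rewrite -mulmxA Piz e normsqZ -subr_ge0 -mulrBl -/m.
  have -> : `|s * (m + 2)| = m + 2.
    have ns : `|s| = 1 by rewrite /s normf_div /m normr_id divff // gt_eqF.
    by rewrite normrM ns mul1r ger0_norm // addr_ge0 // ltW.
  have -> : m ^+ 2 - (m + 2) ^+ 2 = - (4 * (m + 1)) by ring.
  rewrite mulNr oppr_ge0 pmulr_rle0 ?mulr_gt0 ?addr_gt0 //.
  by rewrite eq_le inner_ge0 andbT.
(* Pairing [j] with [sg i j] turns the identity [top] into a bound for the Casimir. *)
have casge : (m ^+ 2 + a%:R * m) * '[u] <= c * '[u].
  rewrite -(innerZr c) -casPi // cas_inner (bigD1 i) //= Hu normsqZ mulrDl lerD2l.
  rewrite (bigID (mem (A i))) /= -[leLHS]addr0 lerD ?sumr_ge0 //; last first.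
    by move=> j _; apply: inner_ge0.
  rewrite (eq_bigl (mem (A i))); last first.
    move=> j; rewrite andb_idl // => jA.
    by have /fintype.subsetP /(_ j jA) := A_sub iY; rewrite !inE andbC.
  rewrite -(@ler_pM2r _ 2) ?ltr0n // mulr_natr [leRHS]mulr_natr.
  rewrite (@sum_involution _ _ (A i) (sg i) _ (2 * m * '[u])).
    by rewrite A_card // -mulr_natr -[leRHS]mulr_natr le_eqVlt; apply/orP; left; apply/eqP; ring.
  by move=> j jA; have [? ? _] := H_raise iY jA; split; rewrite ?top.
rewrite ler_pM2r ?inner_gt0 // in casge.
have Mw : '[w, (\sum_(j in Y) Q j) *m w] = #|Y|%:R * lam * '[w].
  have : T *m w = lam *: w by [].
  rewrite mulmxBl Gw subr0 -scalemxAl => /(congr1 ( *:%R #|Y|%:R)).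
  rewrite !scalerA divff ?gt_eqF // scale1r => ->.
  by rewrite innerZr.
have Qnorm j x : j \in Y -> '[x, Q j *m x] = '[Q j *m x].
  by move=> jY; rewrite -{1}Q_idem // -mulmxA (inner_adj (Q j) x) Q_herm.
(* [H j] sees only the part of [w] orthogonal to its kernel, whose squared norm is the difference on
   the right, and it is bounded by m on the eigenspace. *)
have Qgap j : j \in Y -> '[H j *m w] <= m ^+ 2 * ('[w] - '[w, Q j *m w]).
  move=> jY; have -> : '[w] - '[w, Q j *m w] = '[w - Q j *m w].
    have e : '[Q j *m w, w] = '[w, Q j *m w] by rewrite (inner_adj (Q j)) Q_herm.
    by rewrite innerBr !innerBl e -(Qnorm j w) // subrr subr0.
  have -> : H j *m w = H j *m Pi *m (w - Q j *m w).
    by rewrite -mulmxA mulmxBr Piw mulmxA PiQ // -mulmxA Piw mulmxBr mulmxA HQ // mul0mx subr0.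
  exact: Kmax.
have : c * '[w] <= m ^+ 2 * (#|Y|%:R * '[w] - #|Y|%:R * lam * '[w]).
  rewrite -(innerZr c) -casPi // cas_inner -Mw mulmx_suml inner_sumr.
  apply: (@le_trans _ _ (\sum_(j in Y) m ^+ 2 * ('[w] - '[w, Q j *m w]))).
    exact: ler_sum.
  by rewrite -mulr_sumr sumrB sumr_const mulr_natl.
rewrite -mulrBl mulrA ler_pM2r ?inner_gt0 // => cle.
apply/andP; split.
  have : 0 <= #|Y|%:R * lam * '[w].
    rewrite -Mw mulmx_suml inner_sumr sumr_ge0 // => j jY.
    by rewrite Qnorm // inner_ge0.
  by rewrite pmulr_lge0 ?inner_gt0 // pmulr_rge0.
have {cle} := le_trans casge cle.
(* After division by m^2 the bound m <= t enters, through a / t <= a / m. *)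
have -> : m ^+ 2 + a%:R * m = m ^+ 2 * (1 + a%:R / m) by field; rewrite gt_eqF.
rewrite -[X in _ * (X - _)]mulr1 -mulrBr ler_pM2l ?exprn_gt0 // => cle.
rewrite lerBrDl -lerBrDr ler_pdivrMr // [leRHS]mulrC; apply: le_trans cle.
by rewrite lerD2l ler_wpM2l // lef_pV2 ?posrE ?ltr0n.
Qed.

End SpectralGap.

End HermitianMatrices.

(** * Tensor powers *)

Lemma tensZl (R : comPzRingType) m n p q c (A : 'M[R]_(m, n)) (B : 'M[R]_(p, q)) :
  tensmx (c *: A) B = c *: tensmx A B.
Proof. by apply/matrixP => i j; rewrite !mxE mulrA. Qed.

Lemma tensZr (R : comPzRingType) m n p q c (A : 'M[R]_(m, n)) (B : 'M[R]_(p, q)) :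
  tensmx A (c *: B) = c *: tensmx A B.
Proof. by apply/matrixP => i j; rewrite !mxE mulrCA. Qed.

Lemma tens1 (R : comPzRingType) m n : tensmx (1%:M : 'M[R]_m) (1%:M : 'M[R]_n) = 1%:M.
Proof.
apply/matrixP => i j; case: (mxtens_indexP i) => i1 i2; case: (mxtens_indexP j) => j1 j2.
rewrite tensmxE !mxE (can_eq (@mxtens_indexK _ _)) xpair_eqE.
by rewrite -natrM mulnb.
Qed.

Lemma tensDl (R : comPzRingType) m n p q (A A' : 'M[R]_(m, n)) (B : 'M[R]_(p, q)) :
  tensmx (A + A') B = tensmx A B + tensmx A' B.
Proof. by apply/matrixP => i j; rewrite !mxE mulrDl. Qed.

Lemma tensDr (R : comPzRingType) m n p q (A : 'M[R]_(m, n)) (B B' : 'M[R]_(p, q)) :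
  tensmx A (B + B') = tensmx A B + tensmx A B'.
Proof. by apply/matrixP => i j; rewrite !mxE mulrDr. Qed.

(* The sum of the [A_j] over the [k + 1] factors of the tensor power [k.+1]. *)
Fixpoint dtensmx (R : comPzRingType) n (A : 'M[R]_n) k : 'M[R]_(n ^ k.+1) :=
  if k is k'.+1 then tensmx A 1%:M + tensmx 1%:M (dtensmx A k') else A.

Section TensorPowers.
Variable R : comPzRingType.
Implicit Types n k : nat.

(** Exponents are written [k.+1] throughout: the first tensor power is the matrix itself, which
    makes the base case immediate, and t >= 1 in the theorem. *)
Lemma ntensmx_mul n (A B : 'M[R]_n) k :
  ntensmx A k.+1 *m ntensmx B k.+1 = ntensmx (A *m B) k.+1.
Proof. by elim: k => [//|k IH]; rewrite !ntensmxSS tensmx_mul IH. Qed.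

Lemma ntensmx_1 n k : ntensmx (1%:M : 'M[R]_n) k.+1 = 1%:M.
Proof. by elim: k => [//|k IH]; rewrite !ntensmxSS IH tens1. Qed.

Lemma ntensmx_tr n (A : 'M[R]_n) k : (ntensmx A k.+1)^T = ntensmx A^T k.+1.
Proof. by elim: k => [//|k IH]; rewrite !ntensmxSS trmx_tens IH. Qed.

Lemma dtensmxSS n (A : 'M[R]_n) k :
  dtensmx A k.+1 = tensmx A 1%:M + tensmx 1%:M (dtensmx A k).
Proof. by []. Qed.

Lemma dtensmxD n (A B : 'M[R]_n) k : dtensmx (A + B) k = dtensmx A k + dtensmx B k.
Proof.
elim: k => [//|k IH]; rewrite !dtensmxSS IH tensDl tensDr.
by rewrite addrACA.
Qed.

Lemma dtensmxZ n c (A : 'M[R]_n) k : dtensmx (c *: A) k = c *: dtensmx A k.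
Proof. by elim: k => [//|k IH]; rewrite !dtensmxSS IH tensZl tensZr scalerDr. Qed.

Lemma dtensmx0 n k : dtensmx (0 : 'M[R]_n) k = 0.
Proof. by rewrite -(scale0r 0) dtensmxZ scale0r. Qed.

Lemma dtensmx_sum n I (r : seq I) (P : pred I) (F : I -> 'M[R]_n) k :
  dtensmx (\sum_(i <- r | P i) F i) k = \sum_(i <- r | P i) dtensmx (F i) k.
Proof.
elim/big_rec2 : _ => [|i A B _ <-]; first exact: dtensmx0.
exact: dtensmxD.
Qed.

Lemma dtensmx_tr n (A : 'M[R]_n) k : (dtensmx A k)^T = dtensmx A^T k.
Proof. by elim: k => [//|k IH]; rewrite !dtensmxSS linearD /= !trmx_tens IH !trmx1. Qed.

(** Terms acting on different factors commute, so only equal factors contribute. All relations among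
    the H_P thus reduce to relations among Paulis. *)
Lemma dtensmx_commutator n (A B : 'M[R]_n) k :
  dtensmx A k *m dtensmx B k - dtensmx B k *m dtensmx A k =
  dtensmx (A *m B - B *m A) k.
Proof.
elim: k => [//|k IH]; rewrite !dtensmxSS -IH !mulmxDl !mulmxDr !tensmx_mul.
rewrite !mul1mx !mulmx1 !tensDl !tensDr -!scaleN1r tensZl tensZr !scaleN1r.
rewrite !opprD !addrA.
set x1 := tensmx (A *m B) _; set x2 := tensmx A _; set x3 := tensmx B _.
set x4 := tensmx 1%:M _; set x5 := tensmx (B *m A) _; set x6 := tensmx 1%:M _.
apply/matrixP => i j; rewrite !mxE; ring.
Qed.

Lemma dtensmx_ntensmx_comm n (A B : 'M[R]_n) k : A *m B = B *m A ->
  dtensmx A k *m ntensmx B k.+1 = ntensmx B k.+1 *m dtensmx A k.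
Proof.
move=> AB; elim: k => [//|k IH].
rewrite dtensmxSS ntensmxSS mulmxDl mulmxDr !tensmx_mul.
by rewrite !mul1mx !mulmx1 AB IH.
Qed.

End TensorPowers.

Lemma dtensmx_map (R S : comPzRingType) (f : {rmorphism R -> S}) n (A : 'M[R]_n) k :
  map_mx f (dtensmx A k) = dtensmx (map_mx f A) k.
Proof. by elim: k => [//|k IH]; rewrite !dtensmxSS map_mxD !map_mxT IH !map_mx1. Qed.

Section DtensBound.
Variable C : numClosedFieldType.

Lemma adjT m n p q (A : 'M[C]_(m, n)) (B : 'M[C]_(p, q)) :
  (tensmx A B)^t* = tensmx (A^t*) (B^t*).
Proof. by rewrite trmx_tens map_mxT. Qed.

(** The triangle inequality in squared form: expanding |m x - y|^2 >= 0 gives m |x + y|^2 <= m (m +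
    1) |x|^2 + (m + 1) |y|^2. A one-element list is treated apart to have m > 0. *)
Lemma sum_isometries_bound d (s : seq 'M[C]_d) (u : 'cV[C]_d) :
  (forall U, U \in s -> U^t* *m U = 1%:M) ->
  inner ((\sum_(U <- s) U) *m u) ((\sum_(U <- s) U) *m u)
    <= (size s)%:R ^+ 2 * inner u u.
Proof.
elim: s => [|U s IH] sU.
  by rewrite big_nil mul0mx /inner mulmx0 mxE expr0n mul0r.
have {}IH := IH (fun V Vs => sU V (mem_behead (s := U :: s) Vs)); rewrite big_cons mulmxDl.
have eU : inner (U *m u) (U *m u) = inner u u by rewrite inner_unitary // sU ?mem_head.
case: s IH sU => [|V s] IH sU.
  by rewrite big_nil mul0mx addr0 eU expr1n mul1r.
set x := U *m u in eU *; set y := _ *m u in IH *; set m : C := (size (V :: s))%:R in IH *.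
have m0 : 0 < m by rewrite ltr0n.
have mr : m^* = m by rewrite rmorph_nat.
have -> : (size [:: U, V & s])%:R = m + 1 :> C by rewrite -natr1.
rewrite -(ler_pM2l m0).
have : 0 <= inner (m *: x - y) (m *: x - y) by apply: inner_ge0.
rewrite innerBr !innerBl !innerZr !innerZl mr innerDr !innerDl eU => h.
apply: (@le_trans _ _ (m * (1 + m) * inner u u + (m + 1) * inner y y)).
  rewrite -subr_ge0; apply: le_trans h _; rewrite le_eqVlt; apply/orP; left; apply/eqP; ring.
have -> : m * ((m + 1) ^+ 2 * inner u u) = m * (1 + m) * inner u u + (m + 1) * (m ^+ 2 * inner u u).
  by ring.
by rewrite lerD2l ler_wpM2l // addr_ge0 ?ltW.
Qed.

(** Each of the k + 1 summands lets the isometry [A] act on one factor and is itself an isometry.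
    This is the source of m <= t. *)
Lemma dtensmx_bound n (A : 'M[C]_n) k (u : 'cV[C]_(n ^ k.+1)) : A^t* *m A = 1%:M ->
  inner (dtensmx A k *m u) (dtensmx A k *m u) <= k.+1%:R ^+ 2 * inner u u.
Proof.
move=> uA; suff [s [ss sU ->]] : exists s : seq 'M[C]_(n ^ k.+1),
    [/\ size s = k.+1, (forall U, U \in s -> U^t* *m U = 1%:M) & dtensmx A k = \sum_(U <- s) U].
  by have := sum_isometries_bound u sU; rewrite ss.
elim: k {u} => [|k [s [ss sU e]]].
  by exists [:: A]; split => //= [U|]; [rewrite inE => /eqP -> | rewrite big_seq1].
exists (tensmx A 1%:M :: [seq tensmx (1%:M : 'M[C]_n) U | U <- s]); split.
- by rewrite /= size_map ss.
- move=> U; rewrite inE => /predU1P [->|/mapP [V Vs ->]]; rewrite adjT tensmx_mul.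
    by rewrite uA trmx1 map_mx1 mul1mx tens1.
  by rewrite sU // trmx1 map_mx1 mul1mx tens1.
- rewrite dtensmxSS big_cons big_map e; congr (_ + _).
  elim/big_rec2 : _ => [|U X Y _ <-]; first by rewrite tensmx0.
  by rewrite tensDr.
Qed.

End DtensBound.

(** * Pauli words *)

Section CastSquare.
Variables (R : comPzRingType) (m n : nat) (e : m = n).
Local Notation cast A := (castmx (e, e) A).

(** The types of sizes 2 * 2^n and 2^(n+1) differ by a cast, through which the matrix operations
    have to pass. *)
Lemma castsq_mul (A B : 'M[R]_m) : cast A *m cast B = cast (A *m B).
Proof. by case: n / e. Qed.
Lemma castsq_tr (A : 'M[R]_m) : (cast A)^T = cast A^T.
Proof. by case: n / e. Qed.
Lemma castsq_scale c (A : 'M[R]_m) : cast (c *: A) = c *: cast A.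
Proof. by case: n / e. Qed.
Lemma castsq1 : cast (1%:M : 'M[R]_m) = 1%:M.
Proof. by case: n / e. Qed.
Lemma castsq_map (f : R -> R) (A : 'M[R]_m) : map_mx f (cast A) = cast (map_mx f A).
Proof. by case: n / e. Qed.
End CastSquare.

Lemma sum_tuple_cons (V : nmodType) (I : finType) n (F : n.+1.-tuple I -> V) :
  \sum_w F w = \sum_a \sum_(w : n.-tuple I) F [tuple of a :: w].
Proof.
rewrite pair_big /= (reindex (fun p : I * n.-tuple I => [tuple of p.1 :: p.2])) //.
exists (fun w => (thead w, [tuple of behead w])) => [[a w] _|w _] /=.
  by rewrite theadE; congr (_, _); apply: val_inj.
by rewrite -tuple_eta.
Qed.

Section Pauli.
Variable R : realType.
Local Notation C := (R[i]).
Local Notation word n := (n.-tuple 'I_4).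

(* With 1, x, y, z numbered 0, 1, 2, 3, multiplication up to a phase is bitwise xor. *)
Definition pauli1_mul_index (a b : 'I_4) : 'I_4 :=
  inord (nth 0%N (nth [::] [:: [:: 0; 1; 2; 3]; [:: 1; 0; 3; 2];
                              [:: 2; 3; 0; 1]; [:: 3; 2; 1; 0]]%N a) b).

(** Row [a], column [b]: the cyclic products xy, yz, zx carry the phase i, the reversed ones -i. *)
Definition pauli1_phase (a b : 'I_4) : C :=
  nth 0 (nth [::] [:: [:: 1; 1; 1; 1]; [:: 1; 1; 'i; -'i];
                     [:: 1; -'i; 1; 'i]; [:: 1; 'i; -'i; 1]] a) b.

Definition pauli1_anti (a b : 'I_4) : bool :=
  [&& val a != 0%N, val b != 0%N & a != b].

Lemma Ii2 : 'i * 'i = -1 :> C. Proof. by rewrite -expr2 sqrCi. Qed.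

Lemma pauli1_mul (a b : 'I_4) :
  pauli1 R a *m pauli1 R b = pauli1_phase a b *: pauli1 R (pauli1_mul_index a b).
Proof.
case: a => [[|[|[|[|//]]]] ?]; case: b => [[|[|[|[|//]]]] ?];
  rewrite /pauli1 /pauli1_mul_index /pauli1_phase /= inordK //=;
  apply/matrixP => -[[|[|//]] ?] -[[|[|//]] ?];
  rewrite !(mxE, big_ord_recl, big_ord0) /=;
  rewrite ?(mulr1, mul1r, mulr0, mul0r, addr0, add0r, mulrN1, mulN1r, opprK, mulrN, mulNr, Ii2, oppr0) //.
Qed.

Ltac pauli1_entries :=
  apply/matrixP => -[[|[|//]] ?] -[[|[|//]] ?];
  rewrite !(mxE, big_ord_recl, big_ord0) /=;
  do ?rewrite (mulr1, mul1r, mulr0, mul0r, addr0, add0r, mulrN1, mulN1r, opprK,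
            mulrN, mulNr, Ii2, oppr0, rmorph1, rmorph0, rmorphN, conjCi) //=.

Lemma pauli1_sqr (a : 'I_4) : pauli1 R a *m pauli1 R a = 1%:M.
Proof.
by case: a => [[|[|[|[|//]]]] ?]; rewrite /pauli1 /=; pauli1_entries.
Qed.

Lemma pauli1_tr (a : 'I_4) : (pauli1 R a)^T = (-1) ^+ (val a == 2%N) *: pauli1 R a.
Proof.
by case: a => [[|[|[|[|//]]]] ?]; rewrite /pauli1 /=; pauli1_entries.
Qed.

Lemma pauli1_adj (a : 'I_4) : (pauli1 R a)^t* = pauli1 R a.
Proof.
by case: a => [[|[|[|[|//]]]] ?]; rewrite /pauli1 /=; pauli1_entries.
Qed.

Lemma pauli1_commute (a b : 'I_4) :
  pauli1 R a *m pauli1 R b = (-1) ^+ pauli1_anti a b *: (pauli1 R b *m pauli1 R a).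
Proof.
by case: a => [[|[|[|[|//]]]] ?]; case: b => [[|[|[|[|//]]]] ?];
  rewrite /pauli1 /pauli1_anti /=; pauli1_entries.
Qed.

(** The sum of the squares sigma_a (x) sigma_a is twice the swap of two qubits. *)
Lemma pauli1_complete (i j k l : 'I_2) :
  \sum_a pauli1 R a i j * pauli1 R a k l = 2 * ((i == l) && (j == k))%:R.
Proof.
rewrite !big_ord_recl big_ord0.
case: i => [[|[|//]] ?]; case: j => [[|[|//]] ?];
case: k => [[|[|//]] ?]; case: l => [[|[|//]] ?];
rewrite /pauli1 /= !mxE /= ?(mulr1, mul1r, mulr0, mul0r, addr0, add0r, mulrN1, mulN1r, opprK,
            mulrN, mulNr, Ii2, oppr0, subrr) //; ring.
Qed.

Lemma pauli1_mul_indexK (a b : 'I_4) :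
  pauli1_mul_index a (pauli1_mul_index a b) = b.
Proof.
by apply: val_inj; case: a => [[|[|[|[|//]]]] ?]; case: b => [[|[|[|[|//]]]] ?];
  rewrite /pauli1_mul_index /= !inordK.
Qed.

Definition word_mul n (v w : word n) : word n :=
  [tuple of [seq pauli1_mul_index p.1 p.2 | p <- zip v w]].

Definition word_anti n (v w : word n) : bool :=
  odd (count (fun p => pauli1_anti p.1 p.2) (zip v w)).

Definition y_odd n (w : word n) : bool := odd (count (fun a : 'I_4 => val a == 2%N) w).

Lemma word_mul_cons n a b (v w : word n) :
  word_mul [tuple of a :: v] [tuple of b :: w] =
  [tuple of pauli1_mul_index a b :: word_mul v w].
Proof. exact: val_inj. Qed.

Lemma word_mulK n (v w : word n) : word_mul v (word_mul v w) = w.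
Proof.
elim: n v w => [|n IH] v w; first by rewrite [LHS]tuple0 [RHS]tuple0.
case/tupleP: v => a v; case/tupleP: w => b w.
by rewrite !word_mul_cons IH pauli1_mul_indexK.
Qed.

Lemma pauli_op0 (w : word 0) : pauli_op R w = 1%:M.
Proof.
rewrite tuple0 /pauli_op /=; apply/matrixP => i j; rewrite !castmxE !mxE /=.
by [].
Qed.

Lemma pauli_op_cons n a (w : word n) :
  pauli_op R [tuple of a :: w] = castmx (esym (expnS 2 n), esym (expnS 2 n))
    (tensmx (pauli1 R a) (pauli_op R w)).
Proof.
(* Once [n] is replaced by [size s], the outer casts are identities. *)
case: w => s p; have /eqP e := p; move: p; case: n / e => p.
rewrite (_ : pauli_op R (Tuple p) = pauli_seq R s); last exact: castmx_id.
rewrite (_ : pauli_op R _ = pauli_seq R (a :: s)); last exact: castmx_id.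
by rewrite /=; congr (castmx (_, _) _); apply: eq_irrelevance.
Qed.

Lemma pauli_op_consE n a (w : word n) i j :
  let u k := mxtens_unindex (cast_ord (expnS 2 n) k) in
  pauli_op R [tuple of a :: w] i j =
  pauli1 R a (u i).1 (u j).1 * pauli_op R w (u i).2 (u j).2.
Proof.
move=> u; rewrite pauli_op_cons castmxE [LHS]mxE.
by congr (pauli1 R a _ _ * pauli_op R w _ _); apply: val_inj.
Qed.

Lemma pauli_sqr n (w : word n) : pauli_op R w *m pauli_op R w = 1%:M.
Proof.
elim: n w => [|n IH] w; first by rewrite pauli_op0 mul1mx.
case/tupleP: w => a w; rewrite pauli_op_cons castsq_mul tensmx_mul.
by rewrite pauli1_sqr IH tens1 castsq1.
Qed.

(** Among the four letters only sigma_y is antisymmetric, so Y_n consists of the antisymmetric Pauli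
    operators. *)
Lemma pauli_tr n (w : word n) : (pauli_op R w)^T = (-1) ^+ y_odd w *: pauli_op R w.
Proof.
elim: n w => [|n IH] w; first by rewrite pauli_op0 tuple0 trmx1 scale1r.
case/tupleP: w => a w; rewrite pauli_op_cons castsq_tr trmx_tens pauli1_tr IH.
rewrite tensZl tensZr scalerA castsq_scale /y_odd /= oddD signr_addb.
by case: eqP.
Qed.

Lemma pauli_adj n (w : word n) : (pauli_op R w)^t* = pauli_op R w.
Proof.
elim: n w => [|n IH] w; first by rewrite pauli_op0 trmx1 map_mx1.
case/tupleP: w => a w; rewrite pauli_op_cons castsq_tr castsq_map trmx_tens.
by rewrite map_mxT pauli1_adj IH.
Qed.

Lemma pauli_commute n (v w : word n) :
  pauli_op R v *m pauli_op R w =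
  (-1) ^+ word_anti v w *: (pauli_op R w *m pauli_op R v).
Proof.
elim: n v w => [|n IH] v w; first by rewrite !pauli_op0 [v]tuple0 [w]tuple0 scale1r.
case/tupleP: v => a v; case/tupleP: w => b w.
rewrite !pauli_op_cons !castsq_mul !tensmx_mul pauli1_commute IH.
rewrite tensZl tensZr scalerA castsq_scale /word_anti /= oddD signr_addb.
by case: pauli1_anti.
Qed.

(** The phase stays existential; for anticommuting factors its square is computed afterwards. *)
Lemma pauli_mul n (v w : word n) : exists f : C,
  pauli_op R v *m pauli_op R w = f *: pauli_op R (word_mul v w).
Proof.
elim: n v w => [|n IH] v w; first by exists 1; rewrite !pauli_op0 mul1mx scale1r.
case/tupleP: v => a v; case/tupleP: w => b w; have [f e] := IH v w.
exists (pauli1_phase a b * f); rewrite word_mul_cons.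
by rewrite !pauli_op_cons !castsq_mul !tensmx_mul pauli1_mul e tensZl tensZr scalerA castsq_scale.
Qed.

(** Product over the qubits of the one-qubit swap identity; it makes tr(P X) / N the coefficient of
    P in X. *)
Lemma pauli_complete n (i j k l : 'I_(2 ^ n)) :
  \sum_w pauli_op R w i j * pauli_op R w k l =
  (2 ^ n)%:R * ((i == l) && (j == k))%:R.
Proof.
elim: n i j k l => [|n IH] i j k l.
  rewrite (big_pred1 [tuple]) => [|w]; last by rewrite /= [w]tuple0; apply/esym/eqP.
  have E (x y : 'I_(2 ^ 0)) : x = y by rewrite (ord1 (x : 'I_1)) (ord1 (y : 'I_1)).
  by rewrite pauli_op0 !mxE (E j i) (E k i) (E l i) eqxx !mulr1.
rewrite sum_tuple_cons.
pose e := expnS 2 n; pose u x := mxtens_unindex (cast_ord e x).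
have uE (x y : 'I_(2 ^ n.+1)) : (x == y) = ((u x).1 == (u y).1) && ((u x).2 == (u y).2).
  rewrite -(inj_eq (@cast_ord_inj _ _ e)) -(can_eq (@mxtens_unindexK _ _)).
  by rewrite -xpair_eqE -!surjective_pairing.
transitivity (\sum_a \sum_(w : word n)
   (pauli1 R a (u i).1 (u j).1 * pauli1 R a (u k).1 (u l).1) *
   (pauli_op R w (u i).2 (u j).2 * pauli_op R w (u k).2 (u l).2)).
  apply: eq_bigr => a _; apply: eq_bigr => w _.
  by rewrite !pauli_op_consE mulrACA.
under eq_bigr => a _ do rewrite -mulr_sumr IH.
have NE : (2 ^ n.+1)%:R = 2 * (2 ^ n)%:R :> C by rewrite expnS natrM.
rewrite -mulr_suml pauli1_complete NE mulrACA; congr (_ * _).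
by rewrite -natrM mulnb !uE andbACA.
Qed.

(** Signed sums over words factor over the letters; here each letter contributes 1 + 1 - 1 + 1 =
    2. *)
Lemma sum_y_sign n : \sum_(w : word n) (-1) ^+ y_odd w = (2 ^ n)%:R :> int.
Proof.
elim: n => [|n IH].
  by rewrite (big_pred1 [tuple]) => [//|w]; rewrite /= [w]tuple0; apply/esym/eqP.
rewrite sum_tuple_cons expnS natrM -IH mulr_sumr exchange_big /=.
apply: eq_bigr => w _; rewrite (eq_bigr (fun a : 'I_4 => (-1) ^+ (val a == 2%N) * (-1) ^+ y_odd w)).
  by rewrite -mulr_suml !big_ord_recl big_ord0.
by move=> a _; rewrite /y_odd /= oddD signr_addb; case: eqP.
Qed.

Lemma word_anti_cons n a b (v w : word n) :
  word_anti [tuple of a :: v] [tuple of b :: w] = pauli1_anti a b (+) word_anti v w.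
Proof. by rewrite /word_anti /= oddD; case: pauli1_anti. Qed.

Lemma y_odd_cons n a (v : word n) :
  y_odd [tuple of a :: v] = (val a == 2%N) (+) y_odd v.
Proof. by rewrite /y_odd /= oddD; case: eqP. Qed.

(** A word with a sigma_y has a nontrivial letter, whose factor is 1 + 1 - 1 - 1 = 0. *)
Lemma sum_anti_sign n (v : word n) : y_odd v ->
  \sum_(w : word n) (-1) ^+ word_anti v w = 0 :> int.
Proof.
elim: n v => [|n IH] v; first by rewrite [v]tuple0.
case/tupleP: v => a v; rewrite y_odd_cons sum_tuple_cons exchange_big /= => yv.
rewrite (eq_bigr (fun w => (\sum_b (-1) ^+ pauli1_anti a b) * (-1) ^+ word_anti v w)).
  rewrite -mulr_sumr !big_ord_recl big_ord0.
  move: yv; case: a => [[|[|[|[|//]]]] ?] yv; rewrite /pauli1_anti /= ?mul0r //.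
  by rewrite IH // mulr0.
by move=> w _; rewrite mulr_suml; apply: eq_bigr => b _; rewrite word_anti_cons signr_addb.
Qed.

(** The factor of a letter of [v] is -2 for sigma_y and 2 otherwise. *)
Lemma sum_y_anti_sign n (v : word n) :
  \sum_(w : word n) (-1) ^+ y_odd w * (-1) ^+ word_anti v w =
  (-1) ^+ y_odd v * (2 ^ n)%:R :> int.
Proof.
elim: n v => [|n IH] v.
  rewrite (big_pred1 [tuple]) => [|w]; first by rewrite [v]tuple0.
  by rewrite /= [w]tuple0; apply/esym/eqP.
case/tupleP: v => a v; rewrite y_odd_cons sum_tuple_cons exchange_big /=.
rewrite (eq_bigr (fun w => (\sum_(b : 'I_4) (-1) ^+ (val b == 2%N) * (-1) ^+ pauli1_anti a b)
   * ((-1) ^+ y_odd w * (-1) ^+ word_anti v w))).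
  rewrite -mulr_sumr IH !big_ord_recl big_ord0 signr_addb expnS natrM mulrACA.
  by congr (_ * _); case: a => [[|[|[|[|//]]]] ?].
move=> w _; rewrite mulr_suml; apply: eq_bigr => b _.
by rewrite word_anti_cons y_odd_cons !signr_addb mulrACA.
Qed.

(** Twice the indicator of Y_n is 1 minus the sign of [y_odd]. *)
Lemma card_Yset n : (#|Yset n|.*2 + 2 ^ n = 4 ^ n)%N.
Proof.
have e : \sum_(w : word n) (1 - (-1) ^+ y_odd w) = (#|Yset n|.*2)%:R :> int.
  rewrite -muln2 natrM mulr_natr -[in RHS]sum1_card natr_sum -sumrMnl.
  rewrite [RHS]big_mkcond /=; apply: eq_bigr => w _.
  by rewrite inE -/(y_odd w); case: y_odd.
move: e; rewrite sumrB sum_y_sign sumr_const card_tuple card_ord => /eqP.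
by rewrite subr_eq -natrD eqr_nat => /eqP.
Qed.

Definition anti_set n (v : word n) : {set word n} := [set w in Yset n | word_anti v w].

(** Four times the indicator is (1 - e)(1 - d) with e, d the signs of [y_odd] and [word_anti v]; the
    four terms sum to 4^n, N, 0 and -N, which gives a = N(N-2)/4. *)
Lemma card_anti_set n (v : word n) : v \in Yset n ->
  (#|anti_set v| * 4 + 2 * 2 ^ n = 4 ^ n)%N.
Proof.
rewrite inE -/(y_odd v) => yv.
have e : \sum_(w : word n) ((1 - (-1) ^+ y_odd w) - (-1) ^+ word_anti v w +
   (-1) ^+ y_odd w * (-1) ^+ word_anti v w) = (#|anti_set v| * 4)%:R :> int.
  rewrite natrM mulr_natr -[in RHS]sum1_card natr_sum -sumrMnl.
  rewrite [RHS]big_mkcond /=; apply: eq_bigr => w _.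
  by rewrite !inE -/(y_odd w); case: y_odd; case: word_anti.
move: e; rewrite big_split /= !sumrB sum_y_sign sum_anti_sign // sum_y_anti_sign yv.
rewrite sumr_const card_tuple card_ord expr1 mulN1r subr0 => /eqP.
rewrite -addrA -opprD subr_eq -!natrD eqr_nat addnn -mul2n => /eqP <-; lia.
Qed.

Lemma pauli_neq0 n (w : word n) : pauli_op R w != 0.
Proof.
apply/eqP => w0; have := pauli_sqr w; rewrite w0 mul0mx => /matrixP.
have N0 : (0 < 2 ^ n)%N by rewrite expn_gt0.
move=> /(_ (Ordinal N0) (Ordinal N0)); rewrite !mxE eqxx => /esym /eqP.
by rewrite oner_eq0.
Qed.

Lemma pauli_scale_inj n (w : word n) (a b : C) :
  a *: pauli_op R w = b *: pauli_op R w -> a = b.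
Proof.
move/eqP; rewrite -subr_eq0 -scalerBl scaler_eq0 (negPf (pauli_neq0 w)) orbF.
by rewrite subr_eq0 => /eqP.
Qed.

(** The product of two anticommuting antisymmetric matrices is antisymmetric, so the partner stays
    in Y_n; it anticommutes with P_v because P_w does. Its square is -1, whence f^2 = -1. *)
Lemma word_mul_anti n (v w : word n) : v \in Yset n -> w \in anti_set v ->
  word_mul v w \in anti_set v /\
  exists2 f : C, f ^+ 2 = -1 &
    pauli_op R v *m pauli_op R w = f *: pauli_op R (word_mul v w).
Proof.
rewrite !inE -/(y_odd v) -/(y_odd w) -/(y_odd (word_mul v w)) => yv /andP [yw vw].
have [f e] := pauli_mul v w; set u := word_mul v w in e *.
have ac : pauli_op R w *m pauli_op R v = - (pauli_op R v *m pauli_op R w).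
  by rewrite [in RHS]pauli_commute vw expr1 scaleN1r opprK.
have f2 : f ^+ 2 = -1.
  have : (pauli_op R v *m pauli_op R w) *m (pauli_op R v *m pauli_op R w) = - 1%:M.
    rewrite mulmxA -(mulmxA _ (pauli_op R w)) ac mulmxN mulNmx mulmxA pauli_sqr.
    by rewrite mul1mx pauli_sqr.
  rewrite {1 2}e -scalemxAl -scalemxAr pauli_sqr scalerA -expr2 => e1.
  apply: (@pauli_scale_inj n v); rewrite -[pauli_op R v]mul1mx !scalemxAl e1.
  by rewrite scaleN1r.
have f0 : f != 0.
  by apply/eqP => f0; move/eqP: f2; rewrite f0 expr0n /= eq_sym oppr_eq0 oner_eq0.
have finj : forall g : C, f * g = - f -> g = -1.
  by move=> g e2; apply: (mulfI f0); rewrite e2 mulrN1.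
split; last by exists f.
apply/andP; split.
  have : (pauli_op R v *m pauli_op R w)^T = - (pauli_op R v *m pauli_op R w).
    by rewrite trmx_mul !pauli_tr yv yw !expr1 !scaleN1r mulmxN mulNmx opprK ac.
  rewrite e linearZ /= pauli_tr scalerA -scaleNr => /pauli_scale_inj /finj.
  case: y_odd => // /eqP; rewrite expr0 -subr_eq0 opprK -(natrD _ 1 1) pnatr_eq0 //.
have vu : pauli_op R v *m pauli_op R u = - (pauli_op R u *m pauli_op R v).
  apply: (scalerI f0); rewrite scalemxAr -e scalerN [in RHS]scalemxAl -e.
  by rewrite -!mulmxA ac mulmxN opprK.
have : f *: (pauli_op R v *m pauli_op R u) = f *: ((-1) ^+ word_anti v u *: (pauli_op R u *m pauli_op R v)).
  by rewrite -pauli_commute.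
rewrite vu; case: word_anti => //; rewrite expr0 scale1r => /(scalerI f0) /eqP.
rewrite eq_sym -addr_eq0 -mulr2n -scaler_nat scaler_eq0 pnatr_eq0 /= => /eqP uv0.
have u0 : pauli_op R u = 0 by rewrite -[LHS]mulmx1 -(pauli_sqr v) mulmxA uv0 mul0mx.
by have := pauli_neq0 u; rewrite u0 eqxx.
Qed.

End Pauli.

(** * Rotations *)

Section Rotations.
Variable R : realType.

(** Rodrigues' formula for exp(x X) when X^3 = -X. It covers both iP, where X^2 = -1, and generators
    of planar rotations, where -X^2 projects onto the plane. *)
Definition rotmx n (X : 'M[R]_n) (x : R) : 'M[R]_n :=
  1%:M + sin x *: X + (1 - cos x) *: (X *m X).

Lemma rotmx0 n (X : 'M[R]_n) : rotmx X 0 = 1%:M.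
Proof. by rewrite /rotmx sin0 cos0 subrr !scale0r !addr0. Qed.

Lemma rotmx_comm n (X : 'M[R]_n) x : X *m rotmx X x = rotmx X x *m X.
Proof.
rewrite /rotmx !mulmxDr !mulmxDl mulmx1 mul1mx -!scalemxAl -!scalemxAr.
by rewrite mulmxA.
Qed.

Lemma rotmxD n (X : 'M[R]_n) x y : X *m X *m X = - X ->
  rotmx X x *m rotmx X y = rotmx X (x + y).
Proof.
move=> X3; rewrite /rotmx sinD cosD.
rewrite !mulmxDl !mulmxDr !mul1mx !mulmx1 -!scalemxAl -!scalemxAr !mulmxA !X3 !mulNmx.
by apply/matrixP => i j; rewrite !mxE; ring.
Qed.

Lemma rotmx_tr n (X : 'M[R]_n) x : X^T = - X -> (rotmx X x)^T = rotmx X (- x).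
Proof.
move=> Xt; rewrite /rotmx !linearD /= !linearZ /= trmx_mul Xt trmx1 sinN cosN.
by rewrite mulmxN mulNmx opprK scalerN scaleNr.
Qed.

Lemma rotmx_SO n (X : 'M[R]_n) x : X^T = - X -> X *m X *m X = - X ->
  @SOset R n (rotmx X x).
Proof.
move=> Xt X3.
have orth y : (rotmx X y)^T *m rotmx X y = 1%:M.
  by rewrite rotmx_tr // rotmxD // addNr rotmx0.
(* The rotation is the square of the orthogonal rotation by half the angle, so its determinant is
   1. *)
split => //; rewrite [x]splitr -rotmxD // det_mulmx.
by rewrite -{1}det_tr -det_mulmx orth det1.
Qed.

Lemma is_derive_rotmx n (X : 'M[R]_n) x i j : X *m X *m X = - X ->
  is_derive x (1 : R) (fun y => rotmx X y i j) ((X *m rotmx X x) i j).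
Proof.
move=> X3; have -> : (fun y => rotmx X y i j) =
    cst ((1%:M : 'M[R]_n) i j) + sin * cst (X i j) + (cst 1 - cos) * cst ((X *m X) i j).
  by apply/funext => y; rewrite /rotmx !mxE.
have -> : X *m rotmx X x = cos x *: X + sin x *: (X *m X).
  rewrite /rotmx !mulmxDr mulmx1 -!scalemxAr mulmxA X3.
  by apply/matrixP => k l; rewrite !mxE; ring.
apply: is_derive_eq; rewrite !mxE /GRing.scale /=; ring.
Qed.

Lemma is_derive_ntensmx n (X : 'M[R]_n) (f : R -> 'M[R]_n) x k I J :
  (forall i j, is_derive x (1 : R) (fun y => f y i j) ((X *m f x) i j)) ->
  is_derive x (1 : R) (fun y => ntensmx (f y) k.+1 I J)
    ((dtensmx X k *m ntensmx (f x) k.+1) I J).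
Proof.
move=> df; elim: k I J => [|k IH] I J; first exact: df.
rewrite dtensmxSS ntensmxSS mulmxDl !tensmx_mul !mul1mx.
pose u (K : 'I_(n ^ k.+2)) := mxtens_unindex (K : 'I_(n * n ^ k.+1)).
have -> : (fun y => ntensmx (f y) k.+2 I J) =
    (fun y => f y (u I).1 (u J).1) * (fun y => ntensmx (f y) k.+1 (u I).2 (u J).2).
  by apply/funext => y; rewrite ntensmxSS [LHS]mxE.
have h1 := df (u I).1 (u J).1; have h2 := IH (u I).2 (u J).2.
apply: is_derive_eq.
by rewrite [RHS]mxE [in RHS]mxE [X in _ = _ + X]mxE /GRing.scale /= addrC [X in X + _ = _]mulrC.
Qed.

Lemma is_derive_mulmx_col m n (f : R -> 'M[R]_(m, n)) (F : 'M[R]_(m, n)) (u : 'cV[R]_n) x i :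
  (forall i j, is_derive x (1 : R) (fun y => f y i j) (F i j)) ->
  is_derive x (1 : R) (fun y => (f y *m u) i 0) ((F *m u) i 0).
Proof.
move=> df; have -> : (fun y => (f y *m u) i 0) = \sum_j (fun y => f y i j) * cst (u j 0).
  by apply/funext => y; rewrite mxE fct_sumE.
rewrite [X in is_derive _ _ _ X]mxE.
have -> : \sum_j F i j * u j 0 = \sum_j (f x i j *: 0 + u j 0 *: F i j).
  by apply: eq_bigr => j _; rewrite scaler0 add0r mulrC.
have h j : is_derive x (1 : R) ((fun y => f y i j) * cst (u j 0)) (f x i j *: 0 + u j 0 *: F i j).
  have := df i j => ?; exact: is_deriveM.
elim/big_ind2 : _ => // [|f1 d1 f2 d2 h1 h2]; first exact: is_derive_cst.
exact: is_deriveD.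
Qed.

(** Each coordinate has zero derivative in the angle, since [dtensmx X k] commutes with the rotation
    power and kills [u]; so it keeps its value at angle 0. *)
Lemma ntensmx_rotmx_fix n (X : 'M[R]_n) k (u : 'cV[R]_(n ^ k.+1)) x :
  X *m X *m X = - X -> dtensmx X k *m u = 0 ->
  ntensmx (rotmx X x) k.+1 *m u = u.
Proof.
move=> X3 Xu; rewrite -[RHS]mul1mx -(ntensmx_1 _ n k) -(rotmx0 X).
apply/matrixP => i j; rewrite ord1.
apply: (@is_derive_0_is_cst R (fun y => (ntensmx (rotmx X y) k.+1 *m u) i 0)) => y.
have -> : 0 = (dtensmx X k *m ntensmx (rotmx X y) k.+1 *m u) i 0 :> R.
  by rewrite dtensmx_ntensmx_comm ?rotmx_comm // -mulmxA Xu mulmx0 mxE.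
apply: is_derive_mulmx_col => I J; apply: is_derive_ntensmx => a b.
exact: is_derive_rotmx.
Qed.

End Rotations.

(** * Generation of the special orthogonal group by planar rotations *)

Section PlanarRotations.
Variables (R : realType) (n : nat).

Definition planar (a b : 'cV[R]_n) : 'M[R]_n := a *m b^T - b *m a^T.

Lemma planar_tr a b : (planar a b)^T = - planar a b.
Proof. by rewrite /planar linearB /= !trmx_mul !trmxK opprB. Qed.

Lemma rotmx_mul_col (X : 'M[R]_n) x (z : 'cV[R]_n) :
  rotmx X x *m z = z + sin x *: (X *m z) + (1 - cos x) *: (X *m (X *m z)).
Proof. by rewrite !mulmxDl mul1mx -!scalemxAl mulmxA. Qed.

Section Orthonormal.
Variables a b : 'cV[R]_n.
Hypotheses (aa : a^T *m a = 1%:M) (bb : b^T *m b = 1%:M) (ab : a^T *m b = 0).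

Let ba : b^T *m a = 0.
Proof. by rewrite -[LHS]trmxK trmx_mul trmxK ab trmx0. Qed.

Let Xa : planar a b *m a = - b.
Proof. by rewrite mulmxBl -!mulmxA ba aa mulmx0 mulmx1 sub0r. Qed.

Let Xb : planar a b *m b = a.
Proof. by rewrite mulmxBl -!mulmxA ab bb mulmx0 mulmx1 subr0. Qed.

Lemma planar_cube : planar a b *m planar a b *m planar a b = - planar a b.
Proof.
have XX : planar a b *m planar a b = - (a *m a^T) - b *m b^T.
  by rewrite {2}/planar mulmxBr !mulmxA Xa Xb mulNmx addrC.
by rewrite -mulmxA XX mulmxBr mulmxN !mulmxA Xa Xb mulNmx opprK opprB.
Qed.

Lemma rotmx_planar_fix (z : 'cV[R]_n) x : a^T *m z = 0 -> b^T *m z = 0 ->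
  rotmx (planar a b) x *m z = z.
Proof.
move=> az bz; have Xz : planar a b *m z = 0.
  by rewrite mulmxBl -!mulmxA az bz !mulmx0 subrr.
by rewrite rotmx_mul_col Xz mulmx0 !scaler0 !addr0.
Qed.

(** The angle [acos c] lies in [0, pi], where the sine is nonnegative; hence the sign condition on
    [s]. *)
Lemma rotmx_planar_align c s : 0 <= s -> c ^+ 2 + s ^+ 2 = 1 ->
  rotmx (planar a b) (acos c) *m (c *: a + s *: b) = a.
Proof.
move=> s0 cs; have c1 : -1 <= c <= 1.
  by rewrite -ler_norml -(@ler_pXn2r _ 2) ?nnegrE // expr1n real_normK ?num_real // -cs lerDl sqr_ge0.
have cc : cos (acos c) = c by rewrite acosK // in_itv.
have ss : sin (acos c) = s by rewrite sin_acos // -cs addrAC subrr add0r sqrtr_sqr ger0_norm.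
rewrite rotmx_mul_col cc ss.
have -> : planar a b *m (c *: a + s *: b) = s *: a - c *: b.
  by rewrite mulmxDr -!scalemxAr Xa Xb scalerN addrC.
have -> : planar a b *m (s *: a - c *: b) = - (c *: a + s *: b).
  by rewrite mulmxBr -!scalemxAr Xa Xb scalerN -opprD addrC.
apply/matrixP => i j; rewrite !mxE.
by transitivity ((c ^+ 2 + s ^+ 2) * a i j); [ring | rewrite cs mul1r].
Qed.

End Orthonormal.

(* Column by column, a planar rotation carries [M e_j] to [e_j] while fixing the earlier
   basis vectors; [\det M = 1] excludes [M e_j = - e_j] for the last column. *)
Lemma SO_planar_ind (P : 'M[R]_n -> Prop) : P 1%:M ->
  (forall a b : 'cV[R]_n, a^T *m a = 1%:M -> b^T *m b = 1%:M -> a^T *m b = 0 ->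
     forall x M, P M -> P (rotmx (planar a b) x *m M)) ->
  forall M, @SOset R n M -> P M.
Proof.
move=> P1 PM M SM.
pose e (i : 'I_n) : 'cV[R]_n := delta_mx i 0.
have ee i j : (e i)^T *m e j = (i == j)%:R%:M.
  rewrite trmx_delta mul_delta_mx_cond; apply/matrixP => k l.
  by rewrite !ord1; case: (i == j); rewrite !mxE.
have e0 i j : val i != val j -> (e i)^T *m e j = 0.
  by move=> ij; rewrite ee -val_eqE (negPf ij); apply/matrixP => k l; rewrite !mxE mul0rn.
have eT i (v : 'cV[R]_n) : (e i)^T *m v = (v i 0)%:M.
  rewrite trmx_delta -rowE; apply/matrixP => k l.
  by rewrite !ord1 !mxE eqxx mulr1n.
(* Here [m] counts the trailing basis vectors not yet known to be fixed. *)
suff fixed m : (m <= n)%N -> forall M, @SOset R n M ->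
    (forall i : 'I_n, (i < n - m)%N -> M *m e i = e i) -> P M.
  by apply: (fixed n) => // i; rewrite subnn.
elim: m => [|m IH] mn {}M {}SM fixM.
  suff -> : M = 1%:M by [].
  apply/matrixP => i j; have := fixM j; rewrite subn0 ltn_ord => /(_ isT).
  by rewrite -colE => /matrixP /(_ i 0); rewrite !mxE eqxx andbT.
have jn : (n - m.+1 < n)%N by rewrite ltn_subrL; lia.
pose j := Ordinal jn.
have [MM dM] := SM.
pose f := M *m e j; pose c : R := f j 0; pose r : 'cV[R]_n := f - c *: e j.
have ff : f^T *m f = 1%:M.
  by rewrite trmx_mul -mulmxA (mulmxA M^T) MM mul1mx ee eqxx.
have fe (i : 'I_n) : (i < n - m.+1)%N -> (e i)^T *m f = 0.
  move=> ij; rewrite -(fixM i ij) trmx_mul -mulmxA (mulmxA M^T) MM mul1mx e0 //=; lia.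
have er : (e j)^T *m r = 0.
  by rewrite mulmxBr -scalemxAr ee eqxx eT -/c scalemx1 subrr.
have rr : r^T *m r = (1 - c ^+ 2)%:M.
  rewrite /r [(f - _)^T]linearB /= [(c *: _)^T]linearZ /= mulmxBl !mulmxBr ff -!scalemxAl -!scalemxAr.
  rewrite ee eqxx eT -/c (_ : f^T *m e j = c%:M); last first.
    by rewrite -[LHS]trmxK trmx_mul trmxK eT tr_scalar_mx.
  by apply/matrixP => k l; rewrite !ord1 !mxE /=; ring.
have er0 (i : 'I_n) : (i < n - m.+1)%N -> (e i)^T *m r = 0.
  move=> ij; rewrite mulmxBr fe // -scalemxAr e0 /= ?scaler0 ?subr0 //; lia.
(* The unit vector [b] completing the plane is left free: it is the normalized remainder [r] in
   general, and another basis vector when [M] sends [e j] to its opposite. *)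
have main b s : 0 <= s -> c ^+ 2 + s ^+ 2 = 1 -> f = c *: e j + s *: b ->
    b^T *m b = 1%:M -> (e j)^T *m b = 0 ->
    (forall i : 'I_n, (i < n - m.+1)%N -> (e i)^T *m b = 0) -> P M.
  move=> s0 cs fb bb jb ib.
  have jj : (e j)^T *m e j = 1%:M by rewrite ee eqxx.
  pose X := planar (e j) b.
  have X3 : X *m X *m X = - X by apply: planar_cube.
  have -> : M = rotmx X (- acos c) *m (rotmx X (acos c) *m M).
    by rewrite mulmxA rotmxD // addNr rotmx0 mul1mx.
  apply: PM => //; apply: IH; first exact: ltnW.
    have [gg dg] : @SOset R n (rotmx X (acos c)) by apply: rotmx_SO => //; apply: planar_tr.
    split; last by rewrite det_mulmx dg dM mulr1.
    by rewrite trmx_mul -mulmxA (mulmxA _^T _ M) gg mul1mx.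
  move=> i im; rewrite -mulmxA; have [ij|ij] := eqVneq i j.
    by rewrite ij -/f fb rotmx_planar_align.
  have im' : (i < n - m.+1)%N by move: ij; rewrite -val_eqE /=; lia.
  rewrite fixM // rotmx_planar_fix //.
    by rewrite e0 // eq_sym.
  by rewrite -[LHS]trmxK trmx_mul trmxK ib // trmx0.
have c2 : c ^+ 2 <= 1.
  have : 0 <= (r^T *m r) 0 0.
    by rewrite mxE sumr_ge0 // => k _; rewrite !mxE -expr2 sqr_ge0.
  by rewrite rr !mxE eqxx mulr1n subr_ge0.
have [c1|c1] := eqVneq (c ^+ 2) 1; last first.
  pose s := Num.sqrt (1 - c ^+ 2).
  have s2 : s ^+ 2 = 1 - c ^+ 2 by rewrite sqr_sqrtr // subr_ge0.
  have s0 : s != 0.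
    by rewrite -sqrf_eq0 s2 subr_eq0 eq_sym.
  apply: (main (s^-1 *: r) s).
  - exact: sqrtr_ge0.
  - by rewrite s2; ring.
  - by rewrite scalerA divff // scale1r /r addrC subrK.
  - rewrite [(_ *: r)^T]linearZ /= -scalemxAl -scalemxAr rr -s2 scalerA -scalemx1 scalerA scalemx1.
    by congr (_%:M); field.
  - by rewrite -scalemxAr er scaler0.
  - by move=> i im; rewrite -scalemxAr er0 // scaler0.
have r0 : r = 0.
  have : (r^T *m r) 0 0 = 0 by rewrite rr c1 subrr !mxE mul0rn.
  rewrite mxE => /eqP; rewrite psumr_eq0; last by move=> k _; rewrite !mxE -expr2 sqr_ge0.
  move=> /allP h; apply/matrixP => k l; rewrite !ord1 [RHS]mxE.
  by have := h k; rewrite mem_index_enum => /(_ isT); rewrite !mxE -expr2 sqrf_eq0 => /eqP.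
have fc : f = c *: e j by apply/eqP; rewrite -subr_eq0; apply/eqP.
have : (c == 1) || (c == -1) by rewrite -sqrf_eq1 c1.
case/orP => /eqP cE.
  apply: IH => //; first exact: ltnW.
  move=> i im; have [->|ij] := eqVneq i j; first by rewrite -/f fc cE scale1r.
  by apply: fixM; move: ij; rewrite -val_eqE /=; lia.
(* If a later basis vector exists, a half turn in the plane of [e j] and that vector repairs the
   sign. *)
have [jn'|jn'] := ltnP j.+1 n.
  pose j' := Ordinal jn'; apply: (main (e j') 0) => //.
  - by rewrite c1 expr0n addr0.
  - by rewrite scale0r addr0.
  - by rewrite ee eqxx.
  - by rewrite e0 //=; lia.
  - move=> i im; rewrite e0 //=; lia.
exfalso; have MD : M = diag_mx (\row_i (if i == j then -1 else 1)).
  apply/matrixP => k l; transitivity ((M *m e l) k 0); first by rewrite -colE mxE.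
  have [->|lj] := eqVneq l j.
    rewrite -/f fc cE !mxE eqxx andbT; by case: (k == j); rewrite ?mulr1 ?mulr0.
  rewrite fixM; last by move: lj; rewrite -val_eqE /= => lj; have := ltn_ord l; rewrite /= in jn'; lia.
  rewrite !mxE eqxx andbT; case: (eqVneq k l) => // ->.
  by rewrite (negPf lj).
move: dM; rewrite MD det_diag (bigD1 j) //= mxE eqxx big1 ?mulr1.
  by move=> /eqP; rewrite eq_sym -subr_eq0 opprK -(natrD _ 1 1) pnatr_eq0.
by move=> i ij; rewrite mxE (negPf ij).
Qed.

End PlanarRotations.

(** * Averages over rotations *)

Local Open Scope classical_set_scope.

Lemma mulmx_colP (R : pzRingType) m n p (A : 'M[R]_(m, n)) (u : 'M[R]_(n, p)) (v : 'M[R]_(m, p)) :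
  (forall j, A *m col j u = col j v) -> A *m u = v.
Proof.
move=> h; have cE (M : 'M[R]_(m, p)) i j : col j M i 0 = M i j by rewrite mxE.
apply/matrixP => i j; rewrite -cE -[RHS]cE -h.
by rewrite [col j u]colE mulmxA -colE.
Qed.

(** * Entrywise integrals of matrix-valued functions *)

Section MatrixIntegral.
Context (d : measure_display) (T : measurableType d) (R : realType).
Variables (mu : {measure set T -> \bar R}) (D : set T).
Hypothesis mD : measurable D.

Definition mxint m n (F : T -> 'M[R]_(m, n)) : 'M[R]_(m, n) :=
  \matrix_(i, j) \int[mu]_(x in D) F x i j.

Definition mxintegrable m n (F : T -> 'M[R]_(m, n)) : Prop :=
  forall i j, mu.-integrable D (EFin \o (fun x => F x i j)).

Lemma Rintegral_sum I (s : seq I) (f : I -> T -> R) :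
  (forall i, mu.-integrable D (EFin \o f i)) ->
  \int[mu]_(x in D) (\sum_(i <- s) f i x) = \sum_(i <- s) \int[mu]_(x in D) f i x.
Proof.
move=> fi; elim: s => [|i s IH].
  by rewrite big_nil; under eq_Rintegral do rewrite big_nil; rewrite Rintegral_cst // mul0r.
rewrite big_cons -IH -RintegralD //; first by apply: eq_Rintegral => x _; rewrite big_cons.
rewrite (_ : EFin \o _ = (fun x => \sum_(j <- s) (EFin \o f j) x)%E).
  by apply: integrable_sum => // j _; apply: fi.
by apply/funext => x /=; rewrite sumEFin.
Qed.

Lemma integrableZl_EFin (c : R) (f : T -> R) : mu.-integrable D (EFin \o f) ->
  mu.-integrable D (EFin \o (fun x => c * f x)).
Proof.
move=> fi; rewrite (_ : EFin \o _ = (fun x => c%:E * (EFin \o f) x)%E).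
  exact: integrableZl.
by apply/funext => x /=; rewrite EFinM.
Qed.

Lemma mxint_mull m n p (A : 'M[R]_(p, m)) (F : T -> 'M[R]_(m, n)) :
  mxintegrable F -> mxint (fun x => A *m F x) = A *m mxint F.
Proof.
move=> iF; apply/matrixP => i j; rewrite !mxE.
transitivity (\int[mu]_(x in D) \sum_k A i k * F x k j).
  by apply: eq_Rintegral => x _; rewrite mxE.
rewrite Rintegral_sum; last by move=> k; apply: integrableZl_EFin; apply: iF.
by apply: eq_bigr => k _; rewrite mxE RintegralZl //; apply: iF.
Qed.

Lemma mxint_tr m n (F : T -> 'M[R]_(m, n)) : mxint (fun x => (F x)^T) = (mxint F)^T.
Proof. by apply/matrixP => i j; rewrite !mxE; apply: eq_Rintegral => x _; rewrite mxE. Qed.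

Lemma mxintegrable_tr m n (F : T -> 'M[R]_(m, n)) :
  mxintegrable F -> mxintegrable (fun x => (F x)^T).
Proof.
move=> iF i j; rewrite (_ : EFin \o _ = EFin \o (fun x => F x j i)); first exact: iF.
by apply/funext => x /=; rewrite mxE.
Qed.

Lemma mxint_mulr m n p (A : 'M[R]_(n, p)) (F : T -> 'M[R]_(m, n)) :
  mxintegrable F -> mxint (fun x => F x *m A) = mxint F *m A.
Proof.
move=> iF; apply: trmx_inj; rewrite -mxint_tr trmx_mul -mxint_tr.
rewrite -mxint_mull; last exact: mxintegrable_tr.
by apply/matrixP => i j; rewrite !mxE; apply: eq_Rintegral => x _; rewrite trmx_mul.
Qed.

Lemma eq_mxint m n (F G : T -> 'M[R]_(m, n)) : {in D, F =1 G} -> mxint F = mxint G.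
Proof.
by move=> FG; apply/matrixP => i j; rewrite !mxE; apply: eq_Rintegral => x /FG ->.
Qed.

Lemma mxint_cst m n (A : 'M[R]_(m, n)) : mxint (fun=> A) = fine (mu D) *: A.
Proof. by apply/matrixP => i j; rewrite !mxE Rintegral_cst // mulrC. Qed.

Section Mean.
Variables (n : nat) (F : T -> 'M[R]_n) (c : R).
Hypotheses (iF : mxintegrable F) (muD : mu D = c%:E) (c0 : c != 0).
Let G := c^-1 *: mxint F.

Lemma mean_fix p (u : 'M[R]_(n, p)) : (forall x, D x -> F x *m u = u) -> G *m u = u.
Proof.
move=> Fu; rewrite /G -scalemxAl -mxint_mulr //.
rewrite (@eq_mxint _ _ _ (fun=> u)); last by move=> x; rewrite inE; apply: Fu.
by rewrite mxint_cst muD scalerA mulVf // scale1r.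
Qed.

(* [G^T G] is the mean of the matrices [F(x)^T G = G]. *)
Lemma mean_projection : (forall x, D x -> (F x)^T *m G = G) -> G^T = G /\ G *m G = G.
Proof.
move=> FG; have GG : G^T *m G = G.
  rewrite {1}/G [(_ *: _)^T]linearZ /= -mxint_tr -scalemxAl -mxint_mulr; last exact: mxintegrable_tr.
  rewrite (@eq_mxint _ _ _ (fun=> G)); last by move=> x; rewrite inE; apply: FG.
  by rewrite mxint_cst muD scalerA mulVf // scale1r.
have Gt : G^T = G by rewrite -{1}GG trmx_mul trmxK GG.
by split => //; rewrite -{1}Gt.
Qed.

End Mean.
End MatrixIntegral.

(** * Mean over one full turn: the half angle runs through (-pi, pi) *)

Section RotationAverage.
Variables (R : realType) (n k : nat) (X : 'M[R]_n).
Hypotheses (Xt : X^T = - X) (X3 : X *m X *m X = - X).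
Let mu := @lebesgue_measure R.
Let D : set R := [set x | - (2 * pi) < x < 2 * pi].
Let F (x : R) := ntensmx (rotmx X (x / 2)) k.+1.

Lemma pi2_gt0 : 0 < 2 * pi :> R. Proof. by rewrite mulr_gt0 // pi_gt0. Qed.

Lemma angle_interval : D = `]- (2 * pi), 2 * pi[%classic.
Proof. by apply/seteqP; split => x; rewrite /D /= in_itv. Qed.

Lemma measurable_angles : measurable (D : set (measurableTypeR R)).
Proof. by rewrite angle_interval; exact: measurable_itv. Qed.

Lemma measure_angles : mu D = (4 * pi)%:E.
Proof.
rewrite angle_interval /mu lebesgue_measure_itv /= lte_fin.
have -> : - (2 * pi) < 2 * pi :> R by have := pi2_gt0; lra.
by rewrite -EFinB; congr EFin; ring.
Qed.

Lemma is_derive_rotation_power x I J :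
  is_derive x (1 : R) (fun y => F y I J) (2^-1 * (dtensmx X k *m F x) I J).
Proof.
have h : is_derive (x / 2) (1 : R) (fun y => ntensmx (rotmx X y) k.+1 I J)
    ((dtensmx X k *m F x) I J).
  by apply: is_derive_ntensmx => i j; apply: is_derive_rotmx.
have h2 : is_derive x (1 : R) (fun y => y / 2) 2^-1.
  have -> : (fun y : R => y / 2) = (2^-1 : R) *: (id : R -> R).
    by apply/funext => y; rewrite /= mulrC.
  by apply: is_derive_eq; rewrite /GRing.scale /= mulr1.
rewrite mulrC.
exact: (@is_derive1_comp R (fun y => ntensmx (rotmx X y) k.+1 I J) (fun y => y / 2) x _ _ h h2).
Qed.

Lemma continuous_rotation_power I J : continuous (fun y => F y I J).
Proof.
move=> x; apply/differentiable_continuous/derivable1_diffP.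
by have := is_derive_rotation_power x I J => ?; apply: ex_derive.
Qed.

Lemma continuous_integrable_angles (f : R -> R) : continuous f ->
  mu.-integrable D (EFin \o f).
Proof.
move=> cf.
have fi : mu.-integrable `[- (2 * pi), 2 * pi]%classic (EFin \o f).
  apply: continuous_compact_integrable; first exact: segment_compact.
  exact: continuous_subspaceT.
apply: (integrableS _ _ _ fi); [exact: measurable_itv|exact: measurable_angles|].
by rewrite angle_interval; apply: subset_itv_oo_cc.
Qed.

Lemma integrable_rotation_power : mxintegrable mu D F.
Proof.
move=> I J; apply: continuous_integrable_angles.
exact: continuous_rotation_power.
Qed.

(* The integrand is twice the derivative of [F], whose values at both ends agree. *)
Lemma mxint_rotation_deriv : dtensmx X k *m mxint mu D F = 0.
Proof.
rewrite -mxint_mull; [|exact: measurable_angles|exact: integrable_rotation_power].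
apply/matrixP => I J; rewrite [LHS]mxE [RHS]mxE.
pose f x := 2^-1 * (dtensmx X k *m F x) I J.
have cf : continuous f.
  have -> : f = \sum_K (cst (2^-1 * dtensmx X k I K) * (fun x => F x K J)).
    apply/funext => x; rewrite /f mxE mulr_sumr fct_sumE.
    by apply: eq_bigr => K _; rewrite mulrA.
  move=> x; elim/big_ind : _ => [|g h cg ch|K _]; first exact: cvg_cst.
    exact: cvgD.
  by apply: cvgM; [exact: cvg_cst | exact: continuous_rotation_power].
have fE : \int[mu]_(x in D) f x = 0.
  have if_ : mu.-integrable `[- (2 * pi), 2 * pi] (EFin \o f).
    apply: continuous_compact_integrable; first exact: segment_compact.
    by apply: continuous_subspaceT.
  rewrite angle_interval Rintegral_itv_obnd_cbnd; last first.
    by apply: (integrableS _ _ _ if_) => //; apply: subset_itv_oo_cc.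
  rewrite Rintegral_itv_bndo_bndc; last first.
    by apply: (integrableS _ _ _ if_) => //; apply: subset_itv_co_cc.
  rewrite /Rintegral (@continuous_FTC2 _ f (fun y => F y I J)) //.
  - rewrite /F /rotmx mulNr mulrAC divff ?pnatr_eq0 // mul1r sinN cosN sinpi oppr0.
    by rewrite -EFinB subrr.
  - by have := pi2_gt0; lra.
  - exact: continuous_subspaceT.
  - split.
    + by move=> x _; have := is_derive_rotation_power x I J => ?; apply: ex_derive.
    + by apply: cvg_at_right_filter; apply: continuous_rotation_power.
    + by apply: cvg_at_left_filter; apply: continuous_rotation_power.
  - move=> x _; rewrite derive1E.
    by have := is_derive_rotation_power x I J => ?; rewrite derive_val.
transitivity (2 * \int[mu]_(x in D) f x); last by rewrite fE mulr0.
have fi : mu.-integrable D (EFin \o f).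
  exact: continuous_integrable_angles.
rewrite -RintegralZl //; last exact: measurable_angles.
by apply: eq_Rintegral => x _; rewrite /f mulrA divff ?mul1r ?pnatr_eq0.
Qed.

Definition rotation_mean := (4 * pi)^-1 *: mxint mu D F.

Let pi4_neq0 : 4 * pi != 0 :> R.
Proof. by rewrite mulf_neq0 ?pnatr_eq0 // gt_eqF // pi_gt0. Qed.

Lemma rotation_mean_deriv : dtensmx X k *m rotation_mean = 0.
Proof. by rewrite /rotation_mean -scalemxAr mxint_rotation_deriv scaler0. Qed.

Lemma rotation_mean_fix p (u : 'M[R]_(n ^ k.+1, p)) :
  dtensmx X k *m u = 0 -> rotation_mean *m u = u.
Proof.
move=> Xu; apply: mean_fix => //.
- exact: measurable_angles.
- exact: integrable_rotation_power.
- exact: measure_angles.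
move=> x _; apply: mulmx_colP => j.
by apply: ntensmx_rotmx_fix => //; rewrite colE mulmxA Xu mul0mx.
Qed.

(** The columns of the mean lie in the kernel of [dtensmx X k], so all rotations fix them, in
    particular the transposes, which are rotations by opposite angles. *)
Lemma rotation_mean_projection :
  rotation_mean^T = rotation_mean /\ rotation_mean *m rotation_mean = rotation_mean.
Proof.
apply: mean_projection => //.
- exact: measurable_angles.
- exact: integrable_rotation_power.
- exact: measure_angles.
move=> x _; rewrite -/rotation_mean /F ntensmx_tr rotmx_tr //.
apply: mulmx_colP => j.
by apply: ntensmx_rotmx_fix => //; rewrite colE mulmxA rotation_mean_deriv mul0mx.
Qed.

End RotationAverage.

Section Orthogonal.
Variables (R : realType) (n : nat).

Lemma orthogonal_entry (A : 'M[R]_n) i j : A^T *m A = 1%:M -> `|A i j| <= 1.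
Proof.
move=> /matrixP /(_ j j); rewrite !mxE eqxx mulr1n => AA.
rewrite -(@ler_pXn2r _ 2) ?nnegrE // expr1n real_normK ?num_real // -AA.
rewrite (bigD1 i) //= mxE -expr2 lerDl sumr_ge0 // => l _.
by rewrite mxE -expr2 sqr_ge0.
Qed.

Lemma SOset_tr (A : 'M[R]_n) : SOset A -> SOset A^T.
Proof.
by move=> [AA dA]; split; rewrite ?det_tr // trmxK; apply: mulmx1C.
Qed.

Lemma SOset_mul (A B : 'M[R]_n) : SOset A -> SOset B -> SOset (A *m B).
Proof.
move=> [AA dA] [BB dB]; split; last by rewrite det_mulmx dA dB mulr1.
by rewrite trmx_mul -mulmxA (mulmxA A^T) AA mul1mx.
Qed.
End Orthogonal.

(** * The Haar average as a projection *)

Section HaarMean.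
Variables (R : realType) (n k : nat) (mu : probability (MxBorel R n) R).
Hypothesis haar : is_haar_SO mu.
Local Notation B := (MxBorel R n).
Let D : set B := @SOset R n.
Let F (M : B) := ntensmx (M : 'M[R]_n) k.+1.

Let mD : measurable D. Proof. by case: haar. Qed.
Let muD : mu D = 1%:E. Proof. by case: haar => _ []. Qed.

Lemma continuous_borel_measurable (f : 'M[R]_n -> R) :
  continuous f -> measurable_fun [set: B] (f : B -> R).
Proof.
move=> cf; apply: (measurability _ (RGenOInfty.measurableE R)).
move=> _ [_ [x ->]] <-; rewrite setTI set_itvE; apply: sub_sigma_algebra.
by move/continuousP : cf; apply; exact: open_gt.
Qed.

(** Entries of a tensor power are products of coordinates, which are continuous and so Borel. *)
Lemma measurable_ntensmx I J : measurable_fun [set: B] (fun M : B => F M I J).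
Proof.
rewrite /F; elim: k I J => [|l IH] I J.
  by apply: continuous_borel_measurable; apply: coord_continuous.
pose u (K : 'I_(n ^ l.+2)) := mxtens_unindex (K : 'I_(n * n ^ l.+1)).
have -> : (fun M : B => ntensmx (M : 'M[R]_n) l.+2 I J) =
    (fun M : B => (M : 'M[R]_n) (u I).1 (u J).1) \*
    (fun M : B => ntensmx (M : 'M[R]_n) l.+1 (u I).2 (u J).2).
  by apply/funext => M; rewrite ntensmxSS [LHS]mxE.
apply: measurable_funM; last exact: IH.
by apply: continuous_borel_measurable; apply: coord_continuous.
Qed.

Lemma integrable_ntensmx : mxintegrable mu D F.
Proof.
move=> I J; apply: measurable_bounded_integrable => //.
- by rewrite [X in (X < _)%E]muD ltry.
- by apply: measurable_funTS; apply: measurable_ntensmx.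
- exists 1; split; rewrite ?num_real // => x x1 M [MM _] /=.
  apply: le_trans (ltW x1); apply: orthogonal_entry.
  by rewrite /F ntensmx_tr ntensmx_mul MM ntensmx_1.
Qed.

Lemma continuous_mulmx_left (g : 'M[R]_n) : continuous (fun M : 'M[R]_n => g *m M).
Proof.
move=> M A [P nP PA].
suff : \forall N \near M, forall i j, P i j ((g *m N) i j).
  by apply: filterS => N PN; apply: PA.
apply: (@filter_forall _ _ (fun i N => forall j, P i j ((g *m N) i j)) (nbhs M)) => i.
apply: (@filter_forall _ _ (fun j N => P i j ((g *m N) i j)) (nbhs M)) => j.
have c : continuous (fun N : 'M[R]_n => (g *m N) i j).
  have -> : (fun N : 'M[R]_n => (g *m N) i j) =
      \sum_l (cst (g i l) * (fun N : 'M[R]_n => N l j)).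
    by apply/funext => N; rewrite mxE fct_sumE.
  move=> x; elim/big_ind : _ => [|f h cf ch|l _].
  - exact: (@cst_continuous _ _ (0 : R) x).
  - exact: (cvgD cf ch).
  - exact: (@cvgM _ _ _ _ (cst (g i l)) (fun N : 'M[R]_n => N l j)
      _ _ (cvg_cst _) (@coord_continuous _ _ _ l j x)).
exact: (c M _ (nP i j)).
Qed.

Lemma measurable_mulmx_left (g : 'M[R]_n) :
  measurable_fun [set: B] (fun M : B => (g *m M : B)).
Proof.
apply: (@measurability _ _ B B setT (fun M : B => (g *m M : B)) (@open 'M[R]_n : set (set B)) erefl).
move=> _ [U oU <-]; rewrite setTI; apply: sub_sigma_algebra.
by move/continuousP : (@continuous_mulmx_left g); apply.
Qed.

(** Change of variables M -> g M: it preserves SO(n), and the pushforward of [mu] is [mu]. *)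
Lemma haar_mean_invariant (g : 'M[R]_n) : SOset g ->
  ntensmx g k.+1 *m mxint mu D F = mxint mu D F.
Proof.
move=> Sg; rewrite -mxint_mull //; last exact: integrable_ntensmx.
apply/matrixP => I J; rewrite [LHS]mxE [RHS]mxE.
pose phi (M : B) : B := g *m M.
have phiD : phi @^-1` D = D.
  apply/seteqP; split => M; rewrite /phi /D /= => SM; last exact: SOset_mul.
  have -> : M = g^T *m (g *m M) by rewrite mulmxA Sg.1 mul1mx.
  by apply: SOset_mul => //; apply: SOset_tr.
rewrite /Rintegral; congr fine.
transitivity (\int[pushforward mu phi]_(M in D) (F M I J)%:E)%E; last first.
  apply: eq_measure_integral; first exact: measurable_mulmx_left.
  by move=> ? A mA _; exact: (haar.2.2 g Sg A mA).
rewrite integral_pushforward //.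
- rewrite phiD; apply: eq_integral => M _ /=; congr EFin.
  by rewrite /F ntensmx_mul.
- exact: measurable_mulmx_left.
- by apply/measurable_EFinP; apply: measurable_ntensmx.
- rewrite phiD.
  rewrite (_ : _ \o _ = EFin \o (fun M => (ntensmx g k.+1 *m F M) I J)); last first.
    by apply/funext => M /=; rewrite /F ntensmx_mul.
  have -> : EFin \o (fun M => (ntensmx g k.+1 *m F M) I J) =
     (fun M => \sum_L (EFin \o (fun M => (ntensmx g k.+1 I L * F M L J)%R)) M)%E.
    by apply/funext => M /=; rewrite mxE sumEFin.
  apply: integrable_sum => // L _; apply: integrableZl_EFin => //.
  exact: integrable_ntensmx.
Qed.

(** The factor [1^-1] matches the general lemmas on means, for total mass 1. *)
Let haarE : avg_haar k.+1 mu = 1^-1 *: mxint mu D F.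
Proof. by rewrite invr1 scale1r. Qed.

Lemma haar_mean_projection :
  (avg_haar k.+1 mu)^T = avg_haar k.+1 mu /\
  avg_haar k.+1 mu *m avg_haar k.+1 mu = avg_haar k.+1 mu.
Proof.
rewrite haarE; apply: mean_projection => //; first exact: integrable_ntensmx.
move=> M SM; rewrite invr1 scale1r /F ntensmx_tr; apply: haar_mean_invariant.
exact: SOset_tr.
Qed.

Lemma haar_mean_fix p (u : 'M[R]_(n ^ k.+1, p)) :
  (forall M, SOset M -> ntensmx M k.+1 *m u = u) -> avg_haar k.+1 mu *m u = u.
Proof.
move=> Mu; rewrite haarE; apply: mean_fix => //; exact: integrable_ntensmx.
Qed.

Lemma ntensmx_haar_mean (g : 'M[R]_n) : SOset g ->
  ntensmx g k.+1 *m avg_haar k.+1 mu = avg_haar k.+1 mu.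
Proof. by move=> Sg; rewrite haarE invr1 scale1r haar_mean_invariant. Qed.

End HaarMean.

(** * The Pauli ensemble *)

Section Complexification.
Variable R : realType.
Local Notation C := (R[i]).
Local Notation toC := (real_complex R).
Local Notation "A ^f" := (map_mx toC A) : ring_scope.

Lemma toC_real (x : R) : toC x \is Num.real.
Proof. by rewrite realE -[0](rmorph0 toC) !lecR le_total. Qed.

Lemma toC_conj (x : R) : Num.conj (toC x) = toC x.
Proof. exact/CrealP/toC_real. Qed.

Lemma adj_toC m n (A : 'M[R]_(m, n)) : (A^f)^t* = (A^T)^f.
Proof. by apply/matrixP => i j; rewrite !mxE toC_conj. Qed.

Lemma complex_mx_split m n (u : 'M[C]_(m, n)) :
  exists a b : 'M[R]_(m, n), u = a^f + 'i *: b^f.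
Proof.
exists (map_mx (fun z : C => complex.Re ('Re z)) u), (map_mx (fun z : C => complex.Re ('Im z)) u).
by apply/matrixP => i j; rewrite !mxE !RRe_real ?Creal_Re ?Creal_Im // -Crect.
Qed.

Lemma complex_mx_eq0 m n (a b : 'M[R]_(m, n)) :
  a^f + 'i *: b^f = 0 -> a = 0 /\ b = 0.
Proof.
move=> ab; split; apply/matrixP => i j; move/matrixP: ab => /(_ i j); rewrite !mxE => e.
  have := Re_rect (toC_real (a i j)) (toC_real (b i j)); rewrite e raddf0.
  by move=> /esym /eqP; rewrite fmorph_eq0 => /eqP.
have := Im_rect (toC_real (a i j)) (toC_real (b i j)); rewrite e raddf0.
by move=> /esym /eqP; rewrite fmorph_eq0 => /eqP.
Qed.

(** Real matrices kill a complex matrix exactly when they kill its real and imaginary parts, and [B]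
    fixes each part. *)
Lemma toC_kernel_fix (I : Type) (P : I -> Prop) m n p (A : I -> 'M[R]_(m, n)) (B : 'M[R]_n)
    (u : 'M[C]_(n, p)) :
  (forall v : 'M[R]_(n, p), (forall i, P i -> A i *m v = 0) -> B *m v = v) ->
  (forall i, P i -> (A i)^f *m u = 0) -> B^f *m u = u.
Proof.
move=> AB Au; have [a [b uE]] := complex_mx_split u.
have ab i : P i -> A i *m a = 0 /\ A i *m b = 0.
  move=> Pi; apply: complex_mx_eq0; rewrite !map_mxM scalemxAr -mulmxDr -uE.
  exact: Au.
rewrite uE mulmxDr -scalemxAr -!map_mxM !AB // => i Pi.
- by case: (ab i Pi).
- by case: (ab i Pi).
Qed.

Lemma toC_mx_inj m n : injective (map_mx toC : 'M[R]_(m, n) -> 'M[C]_(m, n)).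
Proof.
move=> A B /matrixP AB; apply/matrixP => i j; have := AB i j; rewrite !mxE.
exact: fmorph_inj.
Qed.

Lemma inner_toC d (v : 'cV[R]_d) : inner (v^f) (v^f) = toC (norm2 v ^+ 2).
Proof.
rewrite innerE sqr_sqrtr; last by rewrite sumr_ge0 // => i _; rewrite sqr_ge0.
rewrite rmorph_sum; apply: eq_bigr => i _; rewrite !mxE toC_conj -rmorphM.
by rewrite expr2.
Qed.

Lemma opnorm_eigen_bound d (A : 'M[R]_d) b : A^T = A -> 0 <= b ->
  (forall (v : 'cV[C]_d) a, v != 0 -> A^f *m v = a *: v -> `|a| <= toC b) ->
  opnorm A <= b.
Proof.
move=> At b0 Ab; apply: ge_sup.
  exists 0, 0; last by rewrite mulmx0 /norm2 big1 ?sqrtr0 // => i _; rewrite mxE expr0n.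
  by rewrite /= /norm2 big1 ?sqrtr0 // => i _; rewrite mxE expr0n.
move=> _ [v v1 <-].
have h : (A^f)^t* = A^f by rewrite adj_toC At.
have bC : 0 <= toC b by rewrite -[0](rmorph0 toC) lecR.
have := hermitian_bound h bC Ab v^f.
rewrite -map_mxM !inner_toC -rmorphXn -rmorphM lecR -exprMn.
have n0 w : 0 <= norm2 (w : 'cV[R]_d) by apply: sqrtr_ge0.
rewrite ler_pXn2r ?nnegrE ?mulr_ge0 // => le1; apply: le_trans le1 _.
by rewrite -[leRHS]mulr1 ler_wpM2l.
Qed.

End Complexification.

Section Exponential.
Variables (R : realType) (n : nat) (X : 'M[R]_n).
Hypothesis X2 : X *m X = - 1%:M.

Lemma mexp_rotmx y : mexp (y *: X) = rotmx X y.
Proof.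
(* Powers of [X] split by parity, in the shape of the cosine and sine coefficients; at [l = 0] the
   truncated [l.-1] is multiplied by 0. *)
have Xl l : (y *: X) ^+ l = y ^+ l *: ((~~ odd l)%:R * (-1) ^+ l./2 *: 1%:M +
     (odd l)%:R * (-1) ^+ l.-1./2 *: X).
  elim: l => [|l IH].
    by rewrite !expr0 !mul1r mul0r scale0r addr0 !scale1r.
  rewrite exprS IH -[_ * _]/(_ *m _) -scalemxAl -scalemxAr scalerA -exprS.
  congr (_ *: _); rewrite mulmxDr -!scalemxAr mulmx1 X2 /=.
  case: l {IH} => [|l] /=; first by rewrite !mul0r !mul1r !scale0r !addr0 add0r.
  rewrite !negbK addrC; case: (odd l); rewrite ?mul0r ?scale0r ?mul1r ?addr0 ?add0r //.
  by rewrite scalerN -scaleNr exprS mulN1r.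
apply/matrixP => i j; rewrite /mexp mxE.
rewrite (_ : (fun m => _) = (series (cos_coeff y) \* cst ((1%:M : 'M[R]_n) i j)) \+
   (series (sin_coeff y) \* cst (X i j))); last first.
  apply/funext => m; rewrite /= !seriesEord /= !mulr_suml -big_split summxE.
  apply: eq_bigr => l _; rewrite Xl !mxE /cos_coeff /sin_coeff /= -?exprnP.
  move: (nat_of_bool (~~ _))%:R (nat_of_bool (odd l))%:R ((-1) ^+ l./2) => p q r.
  move: ((-1) ^+ l.-1./2) (y ^+ l) (l`!%:R^-1) (nat_of_bool _)%:R => u v w z.
  ring.
have -> : rotmx X y i j = cos y * (1%:M : 'M[R]_n) i j + sin y * X i j.
  by rewrite /rotmx X2 !mxE; ring.
apply/cvg_lim => //.
have hc : series (cos_coeff y) @ \oo --> cos y.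
  by rewrite cos.unlock; apply: is_cvg_series_cos_coeff.
have hs : series (sin_coeff y) @ \oo --> sin y.
  by rewrite sin.unlock; apply: is_cvg_series_sin_coeff.
exact: (cvgD (cvgM hc (cvg_cst _)) (cvgM hs (cvg_cst _))).
Qed.

End Exponential.

Section RealPauli.
Variables (R : realType) (n : nat).
Local Notation C := (R[i]).
Local Notation toC := (real_complex R).
Local Notation "A ^f" := (map_mx toC A) : ring_scope.
Local Notation N := (2 ^ n)%N.
Implicit Types w : n.-tuple 'I_4.

(** P is hermitian and antisymmetric, so its conjugate is -P; then iP is real and taking real parts
    loses nothing. *)
Lemma iP_realE w : w \in Yset n -> (iP_real R w)^f = 'i *: pauli_op R w.
Proof.
rewrite inE -/(y_odd w) => yw; apply/matrixP => i j; rewrite 2!mxE.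
apply: RRe_real; apply/CrealP; rewrite !mxE rmorphM /= conjCi.
have /matrixP /(_ i j) := pauli_adj R w; rewrite pauli_tr yw expr1 scaleN1r !mxE rmorphN.
by move=> /eqP; rewrite eqr_oppLR => /eqP ->; rewrite mulrNN.
Qed.

Lemma iP_real_tr w : w \in Yset n -> (iP_real R w)^T = - iP_real R w.
Proof.
move=> wY; apply: toC_mx_inj; rewrite -map_trmx map_mxN iP_realE //.
by move: wY; rewrite inE -/(y_odd w) => yw; rewrite linearZ /= pauli_tr yw expr1 scaleN1r scalerN.
Qed.

Lemma iP_real_sqr w : w \in Yset n -> iP_real R w *m iP_real R w = - 1%:M.
Proof.
move=> wY; apply: toC_mx_inj; rewrite map_mxM map_mxN map_mx1 iP_realE //.
by rewrite -scalemxAl -scalemxAr pauli_sqr scalerA Ii2 scaleN1r.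
Qed.

Lemma iP_real_cube w : w \in Yset n ->
  iP_real R w *m iP_real R w *m iP_real R w = - iP_real R w.
Proof. by move=> wY; rewrite iP_real_sqr // mulNmx mul1mx. Qed.

(** The coefficients are tr(P X) / N, and the trace of a symmetric P against an antisymmetric X
    vanishes. *)
Lemma antisym_pauli_expansion (X : 'M[R]_N) : X^T = - X ->
  exists c : n.-tuple 'I_4 -> C, X^f = \sum_(w in Yset n) c w *: pauli_op R w.
Proof.
move=> Xt; pose c w : C := N%:R^-1 * \tr (pauli_op R w *m X^f).
have N0 : N%:R != 0 :> C by rewrite pnatr_eq0 expn_eq0.
have all_c : X^f = \sum_w c w *: pauli_op R w.
  apply/matrixP => i j; rewrite summxE.
  transitivity (N%:R^-1 * \sum_k \sum_l X^f l k * (\sum_w pauli_op R w k l * pauli_op R w i j)).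
    rewrite (bigD1 j) //= (bigD1 i) //= pauli_complete !eqxx.
    rewrite big1 ?addr0; last first.
      by move=> l li; rewrite pauli_complete (negPf li) andbF !mulr0.
    rewrite big1 ?addr0; first by rewrite /= mulr1 mulrCA mulVf ?mulr1.
    move=> k kj; rewrite big1 // => l _.
    by rewrite pauli_complete (negPf kj) !mulr0.
  rewrite /c (eq_bigr (fun w => N%:R^-1 * (\tr (pauli_op R w *m X^f) * pauli_op R w i j))); last first.
    by move=> w _; rewrite !mxE mulrA.
  rewrite -mulr_sumr; congr (_ * _).
  under eq_bigr => k _ do under eq_bigr => l _ do rewrite mulr_sumr.
  under [RHS]eq_bigr => w _ do rewrite mulr_suml.
  rewrite [RHS]exchange_big /=; apply: eq_bigr => k _.
  rewrite exchange_big /=; apply: eq_bigr => w _.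
  rewrite [(_ *m _) k k]mxE mulr_suml; apply: eq_bigr => l _.
  by rewrite mulrCA mulrA.
exists c; rewrite {1}all_c (bigID (mem (Yset n))) /= [X in _ + X]big1 ?addr0 // => w.
rewrite inE -/(y_odd w) => /negPf yw.
suff -> : c w = 0 by rewrite scale0r.
suff : \tr (pauli_op R w *m X^f) = - \tr (pauli_op R w *m X^f).
  move/eqP; rewrite -addr_eq0 -mulr2n -mulr_natr mulf_eq0 pnatr_eq0 orbF.
  by rewrite /c => /eqP ->; rewrite mulr0.
rewrite -{1}mxtrace_tr trmx_mul pauli_tr yw expr0 scale1r map_trmx Xt map_mxN mulNmx.
by rewrite linearN /= mxtrace_mulC.
Qed.

End RealPauli.

(** * Application to the Pauli operators *)

Section Gap.
Variables (R : realType) (n k : nat) (mu : probability (MxBorel R (2 ^ n)) R).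
Hypothesis haar : is_haar_SO mu.
Local Notation C := (R[i]).
Local Notation toC := (real_complex R).
Local Notation "A ^f" := (map_mx toC A) : ring_scope.
Implicit Types v w : n.-tuple 'I_4.

Let H w : 'M[C]_((2 ^ n) ^ k.+1) := dtensmx (pauli_op R w) k.
Let Q w := rotation_mean k (iP_real R w).
Let G := avg_haar k.+1 mu.
(** The division is exact once Y_n is nonempty, by [card_anti_set]. *)
Let a := ((4 ^ n - 2 * 2 ^ n) %/ 4)%N.

Lemma dtensmx_iP_real w : w \in Yset n -> (dtensmx (iP_real R w) k)^f = 'i *: H w.
Proof. by move=> wY; rewrite dtensmx_map iP_realE // dtensmxZ. Qed.

Lemma pauli_kernel p (u : 'M[C]_(_, p)) w : w \in Yset n ->
  (H w *m u = 0) <-> ((dtensmx (iP_real R w) k)^f *m u = 0).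
Proof.
move=> wY; rewrite dtensmx_iP_real // -scalemxAl; split => [->|]; first by rewrite scaler0.
by move/eqP; rewrite scaler_eq0 (negPf (neq0Ci _)) => /eqP.
Qed.

Lemma pauli_power_herm w : (H w)^t* = H w.
Proof.
rewrite /H dtensmx_tr -[in RHS](pauli_adj R w).
exact: (dtensmx_map (Num.conj : {rmorphism C -> C})).
Qed.

Lemma word_anti_diag w : word_anti w w = false.
Proof.
suff h m (x : m.-tuple 'I_4) : word_anti x x = false by apply: h.
elim: m x => [|m IH] x; first by rewrite [x]tuple0.
by case/tupleP: x => b x; rewrite word_anti_cons /pauli1_anti eqxx !andbF IH.
Qed.

(** All six products among P_v, P_w, P_u follow from P_v P_w = f P_u, using that Paulis square to 1
    and that the inverse of f is -f. *)
Lemma pauli_power_raise v w : v \in Yset n -> w \in anti_set v ->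
  [/\ word_mul v w \in anti_set v, word_mul v (word_mul v w) = w &
    raising_triple (H v) (H w) (H (word_mul v w))].
Proof.
move=> vY wA; have [uA [f f2 e]] := word_mul_anti R vY wA.
split => //; first exact: word_mulK.
set u := word_mul v w in uA e *.
have wv : pauli_op R w *m pauli_op R v = - (f *: pauli_op R u).
  rewrite -e [in RHS]pauli_commute; move: wA; rewrite inE => /andP [_ ->].
  by rewrite expr1 scaleN1r opprK.
have fK (x : 'M[C]_(2 ^ n)) : - f *: (f *: x) = x.
  by rewrite scalerA mulNr -expr2 f2 opprK scale1r.
have vu : pauli_op R v *m pauli_op R u = - f *: pauli_op R w.
  by rewrite -[LHS]fK scalemxAr -e mulmxA pauli_sqr mul1mx.
have uv : pauli_op R u *m pauli_op R v = f *: pauli_op R w.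
  rewrite -[LHS]fK scalemxAl -e -mulmxA wv mulmxN -scalemxAr vu.
  rewrite scalerN !scalerA -scaleNr; congr (_ *: _).
  by transitivity (f * - f ^+ 2); [ring | rewrite f2 opprK mulr1].
have wu : pauli_op R w *m pauli_op R u = f *: pauli_op R v.
  rewrite -[LHS]fK scalemxAr -e mulmxA wv mulNmx -e -mulmxA pauli_sqr mulmx1.
  by rewrite scalerN scaleNr opprK.
have uw : pauli_op R u *m pauli_op R w = - f *: pauli_op R v.
  by rewrite -[LHS]fK scalemxAl -e -mulmxA pauli_sqr mulmx1.
exists f => //; rewrite /H !dtensmx_commutator -!dtensmxZ; split; congr (dtensmx _ k).
- by rewrite e wv opprK -scalerDl mulr2n mulrDl mul1r.
- by rewrite vu uv -scalerBl; congr (_ *: _); ring.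
- by rewrite wu uw -scalerBl; congr (_ *: _); ring.
Qed.

(** A planar generator is a combination of Paulis in Y_n, so by linearity its [dtensmx] kills [u],
    and the rotations it generates fix [u]. *)
Lemma common_kernel_SO (u : 'cV[R]_((2 ^ n) ^ k.+1)) :
  (forall w, w \in Yset n -> dtensmx (iP_real R w) k *m u = 0) ->
  forall M, SOset M -> ntensmx M k.+1 *m u = u.
Proof.
move=> Ju; apply: SO_planar_ind; first by rewrite ntensmx_1 mul1mx.
move=> b c bb cc bc x M Mu; rewrite -ntensmx_mul -mulmxA Mu.
apply: ntensmx_rotmx_fix; first exact: planar_cube.
have [d dE] := antisym_pauli_expansion (planar_tr b c).
apply: (@toC_mx_inj R); rewrite map_mxM dtensmx_map dE dtensmx_sum mulmx_suml raddf0.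
rewrite big1 // => w wY; rewrite dtensmxZ -scalemxAl.
suff -> : dtensmx (pauli_op R w) k *m u^f = 0 by rewrite scaler0.
by apply/(pauli_kernel _ wY); rewrite -map_mxM Ju // raddf0.
Qed.

Lemma avg_YE : avg_Y R n k.+1 = #|Yset n|%:R^-1 *: \sum_(w in Yset n) Q w.
Proof.
congr (_ *: _); apply: eq_bigr => w wY; apply/matrixP => I J.
rewrite !mxE; congr (_ * _); apply: eq_Rintegral => x _.
by rewrite mexp_rotmx //; apply: iP_real_sqr.
Qed.

Lemma avg_eigenvalue (lam : C) (v : 'cV[C]_((2 ^ n) ^ k.+1)) :
  (0 < #|Yset n|)%N -> lam != 0 -> v != 0 ->
  (avg_Y R n k.+1 - avg_haar k.+1 mu)^f *m v = lam *: v ->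
  0 <= lam <= 1 - (1 + a%:R / k.+1%:R) / #|Yset n|%:R.
Proof.
move=> Y0 lam0 v0; rewrite avg_YE map_mxB map_mxZ fmorphV rmorph_nat raddf_sum /= => Tv.
have Qp w : w \in Yset n -> (Q w)^T = Q w /\ Q w *m Q w = Q w.
  by move=> wY; apply: rotation_mean_projection; rewrite ?iP_real_tr ?iP_real_cube.
have [Gt GG] := haar_mean_projection k haar.
apply: (gap_eigenvalue (H := H) (Q := fun w => (Q w)^f) (A := @anti_set n) (sg := @word_mul n)) Tv => //.
- by move=> w _; apply: pauli_power_herm.
- by move=> w u _; apply: dtensmx_bound; rewrite pauli_adj pauli_sqr.
- move=> w wY; apply/fintype.subsetP => u; rewrite !inE => /andP [uY wu]; rewrite uY andbT.
  by apply/eqP => uw; move: wu; rewrite uw word_anti_diag.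
- by move=> w wY; have := card_anti_set wY; rewrite /a => <-; rewrite addnK mulnK.
- move=> v1 w vY wY; rewrite inE wY /= => /negPf vw; apply/eqP; rewrite -subr_eq0.
  by rewrite dtensmx_commutator pauli_commute vw expr0 scale1r subrr dtensmx0.
- exact: pauli_power_raise.
- by move=> w wY; rewrite adj_toC; case: (Qp w wY) => ->.
- by move=> w wY; rewrite -map_mxM; case: (Qp w wY) => _ ->.
- move=> w wY; apply/(pauli_kernel _ wY); rewrite -map_mxM rotation_mean_deriv ?raddf0 //.
  exact: iP_real_cube.
- move=> w u wY Hu; apply: (@toC_kernel_fix R unit (fun=> True) _ _ _ (fun=> dtensmx (iP_real R w) k)).
    by move=> x /(_ tt I); apply: rotation_mean_fix; apply: iP_real_cube.
  by move=> _ _; apply/pauli_kernel.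
- by rewrite adj_toC Gt.
- move=> w wY; apply/(pauli_kernel _ wY); rewrite -map_mxM.
  (* The averaged rotations belong to SO(N) and so fix [G]; then [G] inherits from [Q w] that its
     range lies in the kernel. *)
  have QG : Q w *m G = G.
    apply: mean_fix => //.
    + exact: measurable_angles.
    + exact: integrable_rotation_power (iP_real_cube R wY).
    + exact: measure_angles.
    + by rewrite mulf_neq0 ?pnatr_eq0 // gt_eqF // pi_gt0.
    + move=> x _; apply: ntensmx_haar_mean => //.
      by apply: rotmx_SO; rewrite ?iP_real_tr ?iP_real_cube.
  by rewrite -/G -QG mulmxA rotation_mean_deriv ?mul0mx ?raddf0 //; apply: iP_real_cube.
- move=> u Hu; apply: (@toC_kernel_fix R _ (fun w => w \in Yset n) _ _ _
      (fun w => dtensmx (iP_real R w) k)).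
    by move=> x Jx; apply: haar_mean_fix => //; apply: common_kernel_SO.
  by move=> w wY; apply/pauli_kernel => //; apply: Hu.
Qed.

Lemma opnorm_avg_diff : (1 < n)%N ->
  opnorm (avg_Y R n k.+1 - avg_haar k.+1 mu) <=
  1 - (1 + a%:R / k.+1%:R) / #|Yset n|%:R.
Proof.
move=> n1; have cY := card_Yset n.
have n4 : (4 <= 2 ^ n)%N by rewrite (@leq_exp2l 2 2).
have e4 : (4 ^ n = 2 ^ n * 2 ^ n)%N by rewrite (expnMn 2 2).
(* This makes the claimed bound nonnegative, which also settles the eigenvalue 0. *)
have aY : (a.+1 <= #|Yset n|)%N by rewrite /a; move: cY; rewrite e4; nia.
have Y0 : (0 < #|Yset n|)%N by apply: leq_trans aY.
set b := (X in _ <= X).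
have b0 : 0 <= b.
  rewrite subr_ge0 ler_pdivrMr ?ltr0n // mul1r.
  apply: (@le_trans _ _ (1 + a%:R)); last by rewrite addrC natr1 ler_nat.
  by rewrite lerD2l ler_pdivrMr ?ltr0n // ler_peMr ?ler0n // ler1n.
apply: opnorm_eigen_bound => //.
  rewrite linearB /= (haar_mean_projection k haar).1 avg_YE linearZ /= raddf_sum.
  congr (_ *: _ - _); apply: eq_bigr => w wY.
  by apply: (rotation_mean_projection _ _ _).1; rewrite ?iP_real_tr ?iP_real_cube.
have bE : toC b = 1 - (1 + a%:R / k.+1%:R) / #|Yset n|%:R.
  by rewrite rmorphB rmorphM rmorphD rmorphM !fmorphV !rmorph_nat !rmorph1.
move=> v lam v0 Tv; have [->|lam0] := eqVneq lam 0.
  by rewrite normr0 -(rmorph0 toC) lecR.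
have := avg_eigenvalue Y0 lam0 v0 Tv; rewrite -bE => /andP [l0 lb].
by rewrite ger0_norm.
Qed.

End Gap.

Theorem theorem6p1 (R : realType) (n t : nat) (mu : probability (MxBorel R (2 ^ n)) R) :
  (4 < 2 ^ n)%N -> (1 <= t)%N -> is_haar_SO mu ->
  let N : R := (2 ^ n)%:R in
  opnorm (avg_Y R n t - avg_haar t mu)
    <= 1 - (2 * t%:R)^-1 * ((N - 2) / (N - 1)) - 2 / (N * (N - 1)).
Proof.
move=> n4; case: t => [//|k] _ haar /=; set N : R := (2 ^ n)%:R.
have n1 : (1 < n)%N.
  rewrite ltnNge; apply/negP => n1; move: n4.
  by rewrite ltnNge (@leq_exp2l 2 n 2) // (leq_trans n1).
apply: le_trans (opnorm_avg_diff k haar n1) _.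
have N4 : 4 < N by rewrite ltr_nat.
have YE : #|Yset n|%:R = N * (N - 1) / 2 :> R.
  have := congr1 (fun m => m%:R : R) (card_Yset n).
  rewrite (expnMn 2 2) -muln2 !natrD !natrM -/N => e; lra.
have aE : ((4 ^ n - 2 * 2 ^ n) %/ 4)%:R = N * (N - 2) / 4 :> R.
  have Yn0 : (0 < #|Yset n|)%N.
    by rewrite -(ltr0n R) YE divr_gt0 ?ltr0n // mulr_gt0; lra.
  (* The anticommuting Paulis are counted around a given word of Y_n, so one has to be exhibited. *)
  have [w wY] := card_gt0P Yn0.
  have ce := card_anti_set wY.
  have -> : ((4 ^ n - 2 * 2 ^ n) %/ 4 = #|anti_set w|)%N by rewrite -ce addnK mulnK.
  have := congr1 (fun m => m%:R : R) ce.
  rewrite (expnMn 2 2) !natrD !natrM -/N => e; lra.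
(* With these counts, 1 / |Y_n| = 2 / (N(N-1)) and a / (t |Y_n|) = (N-2) / (2t(N-1)), so the two
   bounds coincide. *)
rewrite YE aE le_eqVlt; apply/orP; left; apply/eqP; field.
have k0 : 0 <= k%:R :> R by rewrite ler0n.
by rewrite -/N !gt_eqF //; lra.
Qed.
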